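(* Let $r>0$. Given an initial condition $m(0)\in\mathrm{Sp}(1)$, let $m(t)=(m_0,m_1,m_2,m_3)$, $t\in\mathbb{R}$, be the all-time solution of the ODE $$\frac{dm}{dt}=\frac{2(r^3+2)(r^3-1)m_2}{r^2}\begin{pmatrix}0&0&m_0&0\\0&0&m_1&0\\-m_0&-m_1&0&-m_3\\0&0&m_3&0\end{pmatrix}m,$$ and let $\varphi(t)=\Phi(r,\Upsilon(\overline{m(t)}))$ be the corresponding solution of the isometric flow. Then there exist subsequences $t_{n_k^\pm}\to\pm\infty$ such that $m(t_{n_k^\pm})\to m_{\pm\infty}\in\mathrm{Sp}(1)$, and $$\varphi_{\pm\infty}=\Phi(r,\Upsilon(\overline{m}_{\pm\infty}))$$ are harmonic $\mathrm{Ad}(\mathrm{Sp}(1))$-invariant coclosed $\mathrm{G}_2$-structures. According to the parameter $r>0$, the flow on $\mathbb{RP}^3=\mathrm{Sp}(1)/\{\pm1\}$ behaves asymptotically as follows, where $\mathbb{RP}^2=\{[(h_0,h_1,0,h_3)]\}$ and $\mathrm{NS}=[(0,0,\pm1,0)]$: if $r<1$, then $m(-\infty)\in\{r\}\times\mathbb{RP}^2$ and $m(+\infty)=[(0,0,\pm1,0)]\in\{r\}\times\mathrm{NS}$; if $r>1$, then $m(+\infty)\in\{r\}\times\mathbb{RP}^2$ and $m(-\infty)=[(0,0,\pm1,0)]\in\{r\}\times\mathrm{NS}$.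
   Context: $\mathfrak{sp}(2)=\{A\in\mathfrak{gl}(2,\mathbb{H}): A+A^*=0\}$, where $A^*=\bar A^T$; $\mathrm{Sp}(1)\subset\mathrm{Sp}(2)$ via $h\mapsto\mathrm{diag}(h,1)$; $\mathbb{S}^7=\mathrm{Sp}(2)/\mathrm{Sp}(1)$, with $o$ the class of the identity; $\mathfrak{p}=\mathfrak{sp}(1)^\perp\simeq T_o\mathbb{S}^7$ (for $\langle A_1,A_2\rangle=\mathrm{Re}\,\mathrm{tr}(A_1A_2^* )$) has basis $e_1=\mathrm{diag}(0,i)$, $e_2=\mathrm{diag}(0,j)$, $e_3=\mathrm{diag}(0,k)$, $e_4=\frac1{\sqrt2}\begin{pmatrix}0&i\\ i&0\end{pmatrix}$, $e_5=\frac1{\sqrt2}\begin{pmatrix}0&j\\ j&0\end{pmatrix}$, $e_6=\frac1{\sqrt2}\begin{pmatrix}0&k\\ k&0\end{pmatrix}$, $e_7=\frac1{\sqrt2}\begin{pmatrix}0&1\\-1&0\end{pmatrix}$, dual basis $e^i$, $e^{ij\cdots}=e^i\wedge e^j\wedge\cdots$; $\omega_1=e^{47}+e^{56}$, $\omega_2=e^{46}-e^{57}$, $\omega_3=e^{45}+e^{67}$. Invariant tensors on $\mathbb{S}^7$ are identified with $\mathrm{Ad}(\mathrm{Sp}(1))$-invariant tensors on $\mathfrak{p}$, and for invariant $1$-forms $d\alpha(X,Y)=-\alpha([X,Y]_{\mathfrak p})$. Elements of $\mathrm{Sp}(1)$ are unit quaternions $h=(h_0,h_1,h_2,h_3)$.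 For a unit quaternion $h$, the $\mathrm{Sp}(2)$-invariant $\mathrm{G}_2$-structure $\Phi(r,\Upsilon(\bar h))=r^3e^{123}+\sum_{i,l=1}^3\Upsilon(h)_{il}\,e^l\wedge\omega_i$, with $$\Upsilon(h)=\begin{pmatrix}h_0^2+h_1^2-h_2^2-h_3^2&2(h_1h_2-h_0h_3)&2(h_1h_3+h_0h_2)\\2(h_1h_2+h_0h_3)&h_0^2-h_1^2+h_2^2-h_3^2&2(h_2h_3-h_0h_1)\\2(h_1h_3-h_0h_2)&2(h_2h_3+h_0h_1)&h_0^2-h_1^2-h_2^2+h_3^2\end{pmatrix},$$ depends only on $[h]=\{\pm h\}\in\mathbb{RP}^3$ and is identified with $(r,[h])$. All of these induce the metric $g_r=r^2\sum_{i\le3}(e^i)^2+\frac1r\sum_{i\ge4}(e^i)^2$. The full torsion tensor $T$ of $\varphi$, with $\psi=*\varphi$, is given by $\nabla_i\varphi_{jkl}=T_i{}^m\psi_{mjkl}$, and $(\mathrm{div}\,T)_j=\nabla^iT_{ij}$. The isometric flow is $\frac{\partial\varphi_t}{\partial t}=(\mathrm{div}\,T_t)^\sharp\lrcorner\psi_t$. $\varphi$ is harmonic if $\mathrm{div}\,T=0$ and coclosed if $d\psi=0$. $m(\pm\infty)$ denotes the limit point $[m_{\pm\infty}]$.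
   Formalization: The limits in RP^2 are claimed only if m(0) is not in NS, and those in NS only if m(0) is not in RP^2 (such points are stationary); for r=1 the limits are claimed coclosed only if m(0) is in RP^2 or NS, since otherwise the constant solution is not coclosed. *)

(* Defs.v *)
From Stdlib Require Import Reals ZArith List Lra.
From Coquelicot Require Import Coquelicot.
Import ListNotations.

Open Scope R_scope.

(* idx indexes the frame e_1, ..., e_7 of p; idx3 indexes omega_1, omega_2,
   omega_3 and the rows and columns of Upsilon. *)

Inductive idx : Set := i1 | i2 | i3 | i4 | i5 | i6 | i7.
Inductive idx3 : Set := u1 | u2 | u3.

Definition idx_Z (i : idx) : Z :=
  match i with i1 => 1 | i2 => 2 | i3 => 3 | i4 => 4 | i5 => 5 | i6 => 6 | i7 => 7 end.

Definition hor (l : idx3) : idx := match l with u1 => i1 | u2 => i2 | u3 => i3 end.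

Definition delta (i j : idx) : R := if Z.eqb (idx_Z i) (idx_Z j) then 1 else 0.

Definition sum7 (F : idx -> R) : R := F i1 + F i2 + F i3 + F i4 + F i5 + F i6 + F i7.
Definition sum3 (F : idx3 -> R) : R := F u1 + F u2 + F u3.

Notation "'Sum' i , F" := (sum7 (fun i => F)) (at level 200, i name, right associativity).

(** Quaternions h = h_0 + h_1 i + h_2 j + h_3 k, with the product topology and
    normed-module structure of R * R * R * R. *)

Notation H := (R * R * R * R)%type.

Definition q0 (h : H) : R := fst (fst (fst h)).
Definition q1 (h : H) : R := snd (fst (fst h)).
Definition q2 (h : H) : R := snd (fst h).
Definition q3 (h : H) : R := snd h.

Definition qmul (a b : H) : H :=
  (q0 a * q0 b - q1 a * q1 b - q2 a * q2 b - q3 a * q3 b,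
   q0 a * q1 b + q1 a * q0 b + q2 a * q3 b - q3 a * q2 b,
   q0 a * q2 b - q1 a * q3 b + q2 a * q0 b + q3 a * q1 b,
   q0 a * q3 b + q1 a * q2 b - q2 a * q1 b + q3 a * q0 b).

Definition qconj (a : H) : H := (q0 a, - q1 a, - q2 a, - q3 a).
Definition qadd (a b : H) : H := (q0 a + q0 b, q1 a + q1 b, q2 a + q2 b, q3 a + q3 b).
Definition qscal (s : R) (a : H) : H := (s * q0 a, s * q1 a, s * q2 a, s * q3 a).

Definition q_zero : H := (0, 0, 0, 0).
Definition q_one : H := (1, 0, 0, 0).
Definition q_i : H := (0, 1, 0, 0).
Definition q_j : H := (0, 0, 1, 0).
Definition q_k : H := (0, 0, 0, 1).

Definition Sp1 (h : H) : Prop := q0 h ^ 2 + q1 h ^ 2 + q2 h ^ 2 + q3 h ^ 2 = 1.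

Record gl2 := mx { m11 : H; m12 : H; m21 : H; m22 : H }.

Definition mmul (A B : gl2) : gl2 :=
  mx (qadd (qmul (m11 A) (m11 B)) (qmul (m12 A) (m21 B)))
     (qadd (qmul (m11 A) (m12 B)) (qmul (m12 A) (m22 B)))
     (qadd (qmul (m21 A) (m11 B)) (qmul (m22 A) (m21 B)))
     (qadd (qmul (m21 A) (m12 B)) (qmul (m22 A) (m22 B))).

Definition madd (A B : gl2) : gl2 :=
  mx (qadd (m11 A) (m11 B)) (qadd (m12 A) (m12 B))
     (qadd (m21 A) (m21 B)) (qadd (m22 A) (m22 B)).

Definition mscal (s : R) (A : gl2) : gl2 :=
  mx (qscal s (m11 A)) (qscal s (m12 A)) (qscal s (m21 A)) (qscal s (m22 A)).

Definition mzero : gl2 := mx q_zero q_zero q_zero q_zero.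

Definition mstar (A : gl2) : gl2 :=
  mx (qconj (m11 A)) (qconj (m21 A)) (qconj (m12 A)) (qconj (m22 A)).

Definition inner (A B : gl2) : R :=
  let C := mmul A (mstar B) in q0 (m11 C) + q0 (m22 C).

Definition bracket (A B : gl2) : gl2 := madd (mmul A B) (mscal (-1) (mmul B A)).

Definition in_sp2 (A : gl2) : Prop := madd A (mstar A) = mzero.

Definition in_p (A : gl2) : Prop :=
  in_sp2 A /\
  forall q : H, qadd q (qconj q) = q_zero -> inner A (mx q q_zero q_zero q_zero) = 0.

Definition e (i : idx) : gl2 :=
  match i with
  | i1 => mx q_zero q_zero q_zero q_i
  | i2 => mx q_zero q_zero q_zero q_j
  | i3 => mx q_zero q_zero q_zero q_k
  | i4 => mscal (/ sqrt 2) (mx q_zero q_i q_i q_zero)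
  | i5 => mscal (/ sqrt 2) (mx q_zero q_j q_j q_zero)
  | i6 => mscal (/ sqrt 2) (mx q_zero q_k q_k q_zero)
  | i7 => mscal (/ sqrt 2) (mx q_zero q_one (qscal (-1) q_one) q_zero)
  end.

(* e is an orthonormal basis of p, so on sp(2) the e_k-coordinate of the
   p-component of A is <A, e_k>. *)

Lemma e_orthonormal (i j : idx) : inner (e i) (e j) = delta i j.
Proof.
assert (Hs : / sqrt 2 * / sqrt 2 = / 2).
{ rewrite <- Rinv_mult, sqrt_sqrt; lra. }
destruct i, j;
  cbv [inner mmul mstar mscal e delta idx_Z Z.eqb Pos.eqb m11 m12 m21 m22
       qadd qmul qconj qscal q_zero q_one q_i q_j q_k q0 q1 q2 q3 fst snd];
  set (s := / sqrt 2) in *; clearbody s; lra.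
Qed.

Lemma e_basis (A : gl2) :
  in_p A <->
  A = fold_right (fun i B => madd (mscal (inner A (e i)) (e i)) B) mzero
        [i1; i2; i3; i4; i5; i6; i7].
Proof.
assert (Hs : / sqrt 2 * / sqrt 2 = / 2).
{ rewrite <- Rinv_mult, sqrt_sqrt; lra. }
destruct A as [[[[a0 a1] a2] a3] [[[b0 b1] b2] b3] [[[c0 c1] c2] c3] [[[d0 d1] d2] d3]].
split.
- intros [HA HB].
  pose proof (HB q_i) as Bi. pose proof (HB q_j) as Bj. pose proof (HB q_k) as Bk.
  clear HB.
  cbv [in_sp2 madd mstar mzero inner mmul m11 m12 m21 m22
       qadd qmul qconj q_zero q_i q_j q_k q0 q1 q2 q3 fst snd] in *.
  injection HA; intros.
  assert (Hz : (0 + 0, 0 + - 0, 0 + - 0, 0 + - 0) = (0, 0, 0, 0)) by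
    (repeat f_equal; ring).
  assert (Ei : (0 + 0, 1 + - 1, 0 + - 0, 0 + - 0) = (0, 0, 0, 0)) by
    (repeat f_equal; ring).
  assert (Ej : (0 + 0, 0 + - 0, 1 + - 1, 0 + - 0) = (0, 0, 0, 0)) by
    (repeat f_equal; ring).
  assert (Ek : (0 + 0, 0 + - 0, 0 + - 0, 1 + - 1) = (0, 0, 0, 0)) by
    (repeat f_equal; ring).
  specialize (Bi Ei). specialize (Bj Ej). specialize (Bk Ek).
  cbv [fold_right in_sp2 madd mstar mzero mscal e inner mmul m11 m12 m21 m22
       qadd qmul qconj qscal q_zero q_one q_i q_j q_k q0 q1 q2 q3 fst snd].
  set (s := / sqrt 2) in *; clearbody s.
  clear HA Hz Ei Ej Ek.
  assert (c0 = - b0) by lra. assert (c1 = b1) by lra.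
  assert (c2 = b2) by lra. assert (c3 = b3) by lra.
  assert (a0 = 0) by lra. assert (d0 = 0) by lra.
  assert (a1 = 0) by lra. assert (a2 = 0) by lra. assert (a3 = 0) by lra.
  subst.
  assert (K : forall x, x = 2 * (s * s) * x) by (intro x; rewrite Hs; field).
  f_equal; repeat apply f_equal2; try ring;
    match goal with
    | |- ?x = _ => rewrite (K x) at 1; ring
    end.
- intros ->.
  cbv [in_p in_sp2 fold_right madd mstar mzero mscal e inner mmul m11 m12 m21 m22
       qadd qmul qconj qscal q_zero q_one q_i q_j q_k q0 q1 q2 q3 fst snd].
  split.
  + f_equal; repeat apply f_equal2; ring.
  + intros [[[x0 x1] x2] x3] Hx. injection Hx; intros. ring_simplify.
    assert (x0 = 0) by lra. subst; ring.
Qed.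

(* bracket_p i j k = e^k([e_i, e_j]_p) *)
Definition bracket_p (i j k : idx) : R := inner (bracket (e i) (e j)) (e k).

(* Ad_p h i k = e^k(Ad(h) e_i) for h in Sp(1), embedded as diag(h, 1) *)
Definition Ad_p (h : H) (i k : idx) : R :=
  let D := mx h q_zero q_zero q_one in inner (mmul (mmul D (e i)) (mstar D)) (e k).

(** Invariant tensors on S^7, given by their components on p in the frame e. *)

Definition tensor1 := idx -> R.
Definition tensor2 := idx -> idx -> R.
Definition tensor3 := idx -> idx -> idx -> R.
Definition tensor4 := idx -> idx -> idx -> idx -> R.

Definition Ad_invariant (phi : tensor3) : Prop :=
  forall h, Sp1 h -> forall i j k,
    (Sum a, Sum b, Sum c, Ad_p h i a * Ad_p h j b * Ad_p h k c * phi a b c) = phi i j k.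

(* alpha /\ beta for 1-forms, and for a 1-form and a 2-form, normalised by
   e^{ij...}(e_i, e_j, ...) = 1 *)
Definition wedge11 (al be : tensor1) : tensor2 := fun i j => al i * be j - al j * be i.
Definition wedge12 (al : tensor1) (om : tensor2) : tensor3 :=
  fun i j k => al i * om j k - al j * om i k + al k * om i j.

Definition omega (f : idx -> tensor1) (l : idx3) : tensor2 := fun i j =>
  match l with
  | u1 => wedge11 (f i4) (f i7) i j + wedge11 (f i5) (f i6) i j
  | u2 => wedge11 (f i4) (f i6) i j - wedge11 (f i5) (f i7) i j
  | u3 => wedge11 (f i4) (f i5) i j + wedge11 (f i6) (f i7) i j
  end.

Definition Upsilon (h : H) (i l : idx3) : R :=
  let h0 := q0 h in let h1 := q1 h in let h2 := q2 h in let h3 := q3 h in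
  match i, l with
  | u1, u1 => h0^2 + h1^2 - h2^2 - h3^2
  | u1, u2 => 2 * (h1 * h2 - h0 * h3)
  | u1, u3 => 2 * (h1 * h3 + h0 * h2)
  | u2, u1 => 2 * (h1 * h2 + h0 * h3)
  | u2, u2 => h0^2 - h1^2 + h2^2 - h3^2
  | u2, u3 => 2 * (h2 * h3 - h0 * h1)
  | u3, u1 => 2 * (h1 * h3 - h0 * h2)
  | u3, u2 => 2 * (h2 * h3 + h0 * h1)
  | u3, u3 => h0^2 - h1^2 - h2^2 + h3^2
  end.

(* Phi r h = r^3 e^{123} + sum_{i,l} Upsilon(h)_{il} e^l /\ omega_i, i.e. the
   3-form written Phi(r, Upsilon(conj h)).  The dual coframe is delta. *)
Definition Phi (r : R) (h : H) : tensor3 := fun a b c =>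
  r^3 * wedge12 (delta i1) (wedge11 (delta i2) (delta i3)) a b c +
  sum3 (fun i => sum3 (fun l =>
    Upsilon h i l * wedge12 (delta (hor l)) (omega delta i) a b c)).

Fixpoint eps (l : list Z) : Z :=
  match l with
  | [] => 1%Z
  | x :: l' => (fold_right (fun y s => Z.sgn (y - x) * s) 1 l' * eps l')%Z
  end.

(* Sign of the permutation (a, ..., m) of (1, ..., 7), 0 if it is not one *)
Definition eps7 (a b c j k l m : idx) : R := IZR (eps (map idx_Z [a; b; c; j; k; l; m])).

Definition det7 (f : idx -> tensor1) : R :=
  Sum a, Sum b, Sum c, Sum j, Sum k, Sum l, Sum m,
    eps7 a b c j k l m *
    (f i1 a * f i2 b * f i3 c * f i4 j * f i5 k * f i6 l * f i7 m).

(* g_{ij}, its inverse g^{ij}, and the coefficient v of the oriented volume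
   form v e^{1...7} *)
Record metric := Metric { lo : tensor2; up : tensor2; vol : R }.

(* phi is the standard G_2 three-form in the coframe f; its metric and its
   orientation are those for which f is an oriented orthonormal coframe.  They
   do not depend on the choice of f, since the stabiliser of the standard form
   in GL(7,R) is contained in SO(7). *)
Definition induces (phi : tensor3) (g : metric) : Prop :=
  exists f : idx -> tensor1,
    (forall i j k,
       phi i j k = wedge12 (f i1) (wedge11 (f i2) (f i3)) i j k +
                   sum3 (fun l => wedge12 (f (hor l)) (omega f l) i j k)) /\
    (forall i j, lo g i j = Sum a, f a i * f a j) /\
    (forall i j, (Sum k, lo g i k * up g k j) = delta i j) /\
    vol g = det7 f.

Definition G2_structure (phi : tensor3) (g : metric) : Prop :=
  Ad_invariant phi /\ induces phi g.

(* (star phi)_{jklm} = 1/3! phi^{abc} vol_{abcjklm} *)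
Definition star (g : metric) (phi : tensor3) : tensor4 := fun j k l m =>
  / 6 * (Sum a, Sum b, Sum c,
    (Sum a', Sum b', Sum c', up g a a' * up g b b' * up g c c' * phi a' b' c') *
    (vol g * eps7 a b c j k l m)).

(* L i j k = e^k(L(e_i) e_j), where L : p -> gl(p) is the difference between the
   Levi-Civita connection and the canonical connection of the reductive
   decomposition sp(2) = sp(1) + p.  The canonical connection is metric with
   torsion -[X, Y]_p and annihilates invariant tensors, so L is determined by
   the following two conditions, and nabla_X acts on invariant tensors as L(X). *)
Definition levi_civita (g : metric) (L : tensor3) : Prop :=
  (forall i j k, L i j k - L j i k = bracket_p i j k) /\
  (forall i j k, (Sum m, L i j m * lo g m k + L i k m * lo g j m) = 0).

(* Derivation index first: nabla3 L phi i j k l = nabla_i phi_{jkl} *)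
Definition nabla2 (L : tensor3) (T : tensor2) : tensor3 := fun i j k =>
  - (Sum m, L i j m * T m k + L i k m * T j m).
Definition nabla3 (L : tensor3) (phi : tensor3) : tensor4 := fun i j k l =>
  - (Sum m, L i j m * phi m k l + L i k m * phi j m l + L i l m * phi j k m).

(* nabla_i phi_{jkl} = T_i^m psi_{mjkl}; it determines T. *)
Definition full_torsion (phi : tensor3) (g : metric) (L : tensor3) (T : tensor2) : Prop :=
  forall i j k l,
    nabla3 L phi i j k l =
    Sum m, (Sum n, T i n * up g n m) * star g phi m j k l.

Definition divT (g : metric) (L : tensor3) (T : tensor2) : tensor1 := fun j =>
  Sum i, Sum k, up g i k * nabla2 L T k i j.

Definition torsion_data (phi : tensor3) (g : metric) (L : tensor3) (T : tensor2) : Prop :=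
  G2_structure phi g /\ levi_civita g L /\ full_torsion phi g L T.

Definition harmonic (phi : tensor3) : Prop :=
  exists g L T, torsion_data phi g L T /\ forall j, divT g L T j = 0.

(* Exterior derivative of an invariant 4-form, extending
   d alpha (X, Y) = - alpha([X, Y]_p):
   sum over s < t of (-1)^(s+t) psi([X_s, X_t]_p, remaining arguments) *)
Definition d4 (psi : tensor4) (i j k l m : idx) : R :=
  let B x y p q s := Sum n, bracket_p x y n * psi n p q s in
  - B i j k l m + B i k j l m - B i l j k m + B i m j k l
  - B j k i l m + B j l i k m - B j m i k l
  - B k l i j m + B k m i j l - B l m i j k.

Definition coclosed (phi : tensor3) : Prop :=
  exists g, G2_structure phi g /\ forall i j k l m, d4 (star g phi) i j k l m = 0.

(* d phi_t / dt = (div T_t)^sharp _| psi_t, with a metric independent of t *)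
Definition isometric_flow (phi : R -> tensor3) : Prop :=
  exists g, forall t, exists L T,
    torsion_data (phi t) g L T /\
    forall i j k,
      is_derive (fun s => phi s i j k) t
        (Sum m, (Sum n, up g m n * divT g L T n) * star g (phi t) m i j k).

Definition dot (x y : H) : R := q0 x * q0 y + q1 x * q1 y + q2 x * q2 y + q3 x * q3 y.

Definition ode_field (r : R) (m : H) : H :=
  let M x := (dot (0, 0, q0 m, 0) x,
              dot (0, 0, q1 m, 0) x,
              dot (- q0 m, - q1 m, 0, - q3 m) x,
              dot (0, 0, q3 m, 0) x) in
  qscal (2 * (r^3 + 2) * (r^3 - 1) * q2 m / r^2) (M m).

Definition all_time_solution (r : R) (m_init : H) (m : R -> H) : Prop :=
  m 0 = m_init /\ forall t, is_derive m t (ode_field r (m t)).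

(* The relation defining RP^3 = Sp(1) / {1, -1} *)
Definition same_class (h h' : H) : Prop := h' = h \/ h' = qscal (-1) h.

Definition in_RP2 (h : H) : Prop :=
  exists h0 h1 h3, Sp1 (h0, h1, 0, h3) /\ same_class (h0, h1, 0, h3) h.

Definition in_NS (h : H) : Prop := same_class (0, 0, 1, 0) h.

(* [m(t)] -> [h] along F in the quotient topology: the quotient map is open, so
   the neighbourhoods of [h] are the images of the neighbourhoods of h. *)
Definition lim_RP3 (F : (R -> Prop) -> Prop) (m : R -> H) (h : H) : Prop :=
  forall U : H -> Prop, locally h U -> F (fun t => exists x, same_class x (m t) /\ U x).

(* Main.v *)
(** The solution of the ODE is explicit: with [c = 2 (r^3 + 2) (r^3 - 1) / r^2], [m t] is
    the point [(a_0, a_1, exp (- c t) a_2, a_3)] divided by its norm, [a] being the initial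
    condition.  So if [c > 0] the [j]-component is killed as [t -> +oo] and the three others
    as [t -> -oo]; if [c < 0] the two ends are exchanged, and if [c = 0] nothing moves.

    That [Phi r (m t)] solves the isometric flow, and that its limits are harmonic, follow
    from [div T = 4 (r^3 + 2) (r^3 - 1) h_2 / r * (- h_3 e^1 - h_0 e^2 + h_1 e^3)].  All
    tensors are explicit polynomials in [h], [r] and [1 / r], so this is a comparison of
    components modulo [|h|^2 = 1]; as forms alternate, only increasing indices are compared. *)

Require Import Defs.
From Stdlib Require Import Reals Lra Lia ZArith List Permutation Sorted Mergesort.
From Stdlib Require Import FunctionalExtensionality.
From Coquelicot Require Import Coquelicot.
Import ListNotations.

Open Scope R_scope.

(** On the unit sphere the ODE is the tangential projection of the linear field x -> - c x_2 j, that
    is, the downward gradient flow of c x_2^2 / 2. Radial projection of a linear flow solves the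
    projected equation; this is where the normalised formula comes from. The limits therefore exist
    along the whole of t -> +-oo, and any sequence of times will do.

    All the metrics agree because [Upsilon h] is a rotation: [Phi r h] is the standard form in a
    coframe whose horizontal part is rotated by it. One metric, one volume and one Levi-Civita
    tensor thus serve every h; only the torsion depends on h, and it is supplied in closed form and
    checked against its defining equation.

    The obstacle is size: [star] sums 7^6 terms and [det7] sums 7^7. The diagonal metric and the
    zero entries of the coframe shrink the sums first, and the remaining coefficients are computed
    in [Z], where zero terms vanish before [ring] sees them. *)

(** * Alternating tensors *)

Lemma sum7_ext (F G : idx -> R) : (forall i, F i = G i) -> sum7 F = sum7 G.
Proof. intros E; unfold sum7; now rewrite !E. Qed.

Lemma sum7_opp (F : idx -> R) : (Sum i, - F i) = - sum7 F.
Proof. unfold sum7; ring. Qed.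

Lemma sum7_plus (F G : idx -> R) : (Sum i, F i + G i) = sum7 F + sum7 G.
Proof. unfold sum7; ring. Qed.

Lemma sum7_mult_l (c : R) (F : idx -> R) : (Sum i, c * F i) = c * sum7 F.
Proof. unfold sum7; ring. Qed.

Definition alternating (F : list idx -> R) : Prop :=
  forall p x y q, F (p ++ x :: y :: q) = - F (p ++ y :: x :: q).

(** Only vanishing is transported, so no sign of a permutation has to be tracked. *)
Lemma alternating_permutation (F : list idx -> R) (l l' : list idx) :
  alternating F -> Permutation l l' -> F l = 0 -> F l' = 0.
Proof.
intros HF HP.
(* The arbitrary prefix lets the induction pass under a common head. *)
enough (forall p, F (p ++ l) = 0 <-> F (p ++ l') = 0) as E by apply (E []).
induction HP as [|x l l' _ IH|x y l|l1 l2 l3 _ IH1 _ IH2]; intros p.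
- reflexivity.
- specialize (IH (p ++ [x])). now rewrite <- !app_assoc in IH.
- rewrite (HF p y x l). lra.
- now rewrite IH1.
Qed.

Definition idx_lt (i j : idx) : bool := (idx_Z i <? idx_Z j)%Z.

Module IdxOrder.
  Definition t := idx.
  Definition leb (i j : idx) : bool := (idx_Z i <=? idx_Z j)%Z.
  Lemma leb_total : forall i j, leb i j = true \/ leb j i = true.
  Proof. intros i j; unfold leb; rewrite !Z.leb_le; lia. Qed.
End IdxOrder.
Module IdxSort := Sort IdxOrder.

Lemma idx_Z_inj (i j : idx) : idx_Z i = idx_Z j -> i = j.
Proof. now destruct i, j. Qed.

Lemma sorted_strict_or_repeat (l : list idx) :
  Sorted (fun i j => is_true (IdxOrder.leb i j)) l ->
  Sorted (fun i j => idx_lt i j = true) l \/ exists p x q, l = p ++ x :: x :: q.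
Proof.
induction 1 as [|x l _ IH Hx]; [now left; constructor|].
destruct IH as [IH|(p & y & q & ->)]; [|right; now exists (x :: p), y, q].
destruct Hx as [|y l Hy]; [left; repeat constructor|].
apply Z.leb_le, Zle_lt_or_eq in Hy as [Hy|Hy].
- left. constructor; [easy|constructor]. now apply Z.ltb_lt.
- right. apply idx_Z_inj in Hy as ->. now exists [], y, l.
Qed.

(** Sorting the indices either makes them strictly increasing or puts two equal ones side by side;
    in the latter case swapping them gives F = - F. *)
Lemma alternating_zero (F : list idx -> R) (n : nat) :
  alternating F ->
  (forall l, length l = n -> Sorted (fun i j => idx_lt i j = true) l -> F l = 0) ->
  forall l, length l = n -> F l = 0.
Proof.
intros HF H0 l Hl.
pose proof (IdxSort.Permuted_sort l) as HP.
apply (alternating_permutation F (IdxSort.sort l)); [easy|now symmetry|].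
assert (Hn : length (IdxSort.sort l) = n)
  by (rewrite <- Hl; symmetry; now apply Permutation_length).
destruct (sorted_strict_or_repeat _ (IdxSort.Sorted_sort l)) as [S|(p & x & q & E)].
- now apply H0.
- rewrite E. pose proof (HF p x x q). lra.
Qed.

Definition alt3 (F : tensor3) : Prop :=
  (forall i j k, F i j k = - F j i k) /\ (forall i j k, F i j k = - F i k j).
Definition alt4 (F : tensor4) : Prop :=
  (forall i j k l, F i j k l = - F j i k l) /\ (forall i, alt3 (F i)).
Definition alt5 (F : idx -> tensor4) : Prop :=
  (forall i j k l m, F i j k l m = - F j i k l m) /\ (forall i, alt4 (F i)).

Lemma alt3_zero (F : tensor3) : alt3 F ->
  (forall i j k, idx_lt i j = true -> idx_lt j k = true -> F i j k = 0) ->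
  forall i j k, F i j k = 0.
Proof.
intros [H12 H23] H0 i j k.
(* The default 0 keeps the function alternating on lists of any other length. *)
apply (alternating_zero (fun l => match l with [i; j; k] => F i j k | _ => 0 end) 3)
  with (l := [i; j; k]); [| |easy].
- intros p x y q.
  destruct p as [|a [|b [|c p]]]; simpl; [..|destruct p; simpl; ring];
    destruct q as [|d [|e q]]; simpl; auto; ring.
- intros [|a [|b [|c [|]]]] Hl HS; try discriminate Hl.
  inversion_clear HS as [|? ? HS' HR]. inversion_clear HR.
  inversion_clear HS' as [|? ? _ HR]. inversion_clear HR.
  now apply H0.
Qed.

Lemma alt4_zero (F : tensor4) : alt4 F ->
  (forall i j k l, idx_lt i j = true -> idx_lt j k = true -> idx_lt k l = true ->
     F i j k l = 0) ->
  forall i j k l, F i j k l = 0.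
Proof.
intros [H12 H3] H0 i j k l.
apply (alternating_zero (fun l => match l with [i; j; k; l] => F i j k l | _ => 0 end) 4)
  with (l := [i; j; k; l]); [| |easy].
- intros p x y q.
  destruct p as [|a [|b [|c [|? p]]]]; simpl; [..|destruct p; simpl; ring];
    destruct q as [|d [|e [|? q]]]; simpl; auto; try ring; now apply H3.
- intros [|a [|b [|c [|d [|]]]]] Hl HS; try discriminate Hl.
  inversion_clear HS as [|? ? HS' HR]. inversion_clear HR.
  inversion_clear HS' as [|? ? HS HR]. inversion_clear HR.
  inversion_clear HS as [|? ? _ HR]. inversion_clear HR.
  now apply H0.
Qed.

Lemma alt5_zero (F : idx -> tensor4) : alt5 F ->
  (forall i j k l m, idx_lt i j = true -> idx_lt j k = true -> idx_lt k l = true ->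
     idx_lt l m = true -> F i j k l m = 0) ->
  forall i j k l m, F i j k l m = 0.
Proof.
intros [H12 H4] H0 i j k l m.
apply (alternating_zero
         (fun l => match l with [i; j; k; l; m] => F i j k l m | _ => 0 end) 5)
  with (l := [i; j; k; l; m]); [| |easy].
- intros p x y q.
  destruct p as [|a [|b [|c [|? [|? p]]]]]; simpl; [..|destruct p; simpl; ring];
    destruct q as [|d [|e [|? [|? q]]]]; simpl; auto; try ring;
    try apply (H4 a); now apply (H4 a).
- intros [|a [|b [|c [|d [|? [|]]]]]] Hl HS; try discriminate Hl.
  inversion_clear HS as [|? ? HS' HR]. inversion_clear HR.
  inversion_clear HS' as [|? ? HS HR]. inversion_clear HR.
  inversion_clear HS as [|? ? HS' HR]. inversion_clear HR.
  inversion_clear HS' as [|? ? _ HR]. inversion_clear HR.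
  now apply H0.
Qed.

Lemma alt3_minus (F G : tensor3) :
  alt3 F -> alt3 G -> alt3 (fun i j k => F i j k - G i j k).
Proof.
intros [F1 F2] [G1 G2].
split; intros; [rewrite F1, G1|rewrite F2, G2]; ring.
Qed.

Lemma alt4_minus (F G : tensor4) :
  alt4 F -> alt4 G -> alt4 (fun i j k l => F i j k l - G i j k l).
Proof.
intros [F1 F2] [G1 G2].
split; [intros; rewrite F1, G1; ring|intros; now apply alt3_minus].
Qed.

Lemma alt3_ext (F G : tensor3) : alt3 F -> alt3 G ->
  (forall i j k, idx_lt i j = true -> idx_lt j k = true -> F i j k = G i j k) ->
  forall i j k, F i j k = G i j k.
Proof.
intros HF HG E i j k. apply Rminus_diag_uniq.
apply (alt3_zero (fun i j k => F i j k - G i j k)); [now apply alt3_minus|].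
intros. rewrite E; [ring|easy|easy].
Qed.

Lemma alt4_ext (F G : tensor4) : alt4 F -> alt4 G ->
  (forall i j k l, idx_lt i j = true -> idx_lt j k = true -> idx_lt k l = true ->
     F i j k l = G i j k l) ->
  forall i j k l, F i j k l = G i j k l.
Proof.
intros HF HG E i j k l. apply Rminus_diag_uniq.
apply (alt4_zero (fun i j k l => F i j k l - G i j k l)); [now apply alt4_minus|].
intros. rewrite E; [ring|easy|easy|easy].
Qed.

Lemma alt3_sum (w : idx -> R) (F : tensor4) :
  (forall m, alt3 (F m)) -> alt3 (fun i j k => Sum m, w m * F m i j k).
Proof.
intros HF; split; intros; rewrite <- sum7_opp; apply sum7_ext; intros m;
  destruct (HF m) as [H1 H2]; [rewrite H1|rewrite H2]; ring.
Qed.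

Lemma alt3_wedge (al be ga : tensor1) : alt3 (wedge12 al (wedge11 be ga)).
Proof. split; intros; unfold wedge12, wedge11; ring. Qed.

Lemma alt3_wedge_omega (al : tensor1) (f : idx -> tensor1) (l : idx3) :
  alt3 (wedge12 al (omega f l)).
Proof. split; intros; destruct l; unfold wedge12, omega, wedge11; ring. Qed.

Lemma alt3_sum3 (F : idx3 -> tensor3) :
  (forall l, alt3 (F l)) -> alt3 (fun i j k => sum3 (fun l => F l i j k)).
Proof.
intros HF; unfold sum3; split; intros;
  destruct (HF u1) as [A1 A2], (HF u2) as [B1 B2], (HF u3) as [C1 C2];
  [rewrite A1, B1, C1|rewrite A2, B2, C2]; ring.
Qed.

Lemma alt3_scal (a : R) (F : tensor3) : alt3 F -> alt3 (fun i j k => a * F i j k).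
Proof. intros [F1 F2]; split; intros; [rewrite F1|rewrite F2]; ring. Qed.

Lemma alt3_plus (F G : tensor3) :
  alt3 F -> alt3 G -> alt3 (fun i j k => F i j k + G i j k).
Proof. intros [F1 F2] [G1 G2]; split; intros; [rewrite F1, G1|rewrite F2, G2]; ring. Qed.

Lemma alt3_Phi (r : R) (h : H) : alt3 (Phi r h).
Proof.
apply (alt3_plus (fun i j k => _ * _) (fun i j k => sum3 _)).
- apply alt3_scal, alt3_wedge.
- apply (alt3_sum3 (fun i a b c => sum3 _)); intros i.
  apply (alt3_sum3 (fun l a b c => _ * _)); intros l.
  apply alt3_scal, alt3_wedge_omega.
Qed.

Lemma alt3_nabla3 (L : tensor3) (phi : tensor3) (i : idx) :
  alt3 phi -> alt3 (nabla3 L phi i).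
Proof.
intros [H1 H2]; split; intros; unfold nabla3; f_equal; rewrite <- sum7_opp;
  apply sum7_ext; intros m.
- rewrite (H1 m), (H1 i0 m), (H1 i0 j m). ring.
- rewrite (H2 m), (H2 i0 m), (H2 i0 j m). ring.
Qed.

Lemma alt4_plus (F G : tensor4) :
  alt4 F -> alt4 G -> alt4 (fun i j k l => F i j k l + G i j k l).
Proof.
intros [F1 F2] [G1 G2]; split; [intros; rewrite F1, G1; ring|].
intros i. now apply alt3_plus.
Qed.

Lemma alt4_sum3 (F : idx3 -> tensor4) :
  (forall l, alt4 (F l)) -> alt4 (fun i j k m => sum3 (fun l => F l i j k m)).
Proof.
intros HF; split.
- intros; unfold sum3.
  rewrite (proj1 (HF u1)), (proj1 (HF u2)), (proj1 (HF u3)). ring.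
- intros i. apply (alt3_sum3 (fun l => F l i)). intros l. apply (HF l).
Qed.

Lemma alt4_scal (a : R) (F : tensor4) : alt4 F -> alt4 (fun i j k l => a * F i j k l).
Proof.
intros [F1 F2]; split; [intros; rewrite F1; ring|].
intros i; now apply alt3_scal.
Qed.

Lemma alt4_sum (w : idx -> R) (F : idx -> tensor4) :
  (forall m, alt4 (F m)) -> alt4 (fun i j k l => Sum m, w m * F m i j k l).
Proof.
intros HF; split.
- intros; rewrite <- sum7_opp; apply sum7_ext; intros m.
  rewrite (proj1 (HF m)). ring.
- intros i. apply (alt3_sum w (fun m => F m i)). intros m. apply (HF m).
Qed.

Lemma sum7_delta (F : idx -> R) (j : idx) : (Sum i, F i * delta i j) = F j.
Proof. destruct j; cbv [sum7 delta idx_Z Z.eqb Pos.eqb]; ring. Qed.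

Lemma delta_sym (i j : idx) : delta i j = delta j i.
Proof. now destruct i, j. Qed.

(** * The Hodge dual *)

(* Unlike [x * IZR z], this reduces to [0] for [z = 0], so that the vanishing terms of
   a component disappear by computation. *)
Definition zscal (z : Z) (x : R) : R :=
  match z with
  | Z0 => 0
  | Zpos xH => x
  | Zneg xH => - x
  | _ => x * IZR z
  end.

Lemma zscalE (z : Z) (x : R) : x * IZR z = zscal z x.
Proof. destruct z as [|[]|[]]; unfold zscal; ring. Qed.

(** Integer copies of the forms in the frame: at concrete indices their components evaluate to
    literals, on which [zscal] computes. *)
Definition deltaZ (i j : idx) : Z := if Z.eqb (idx_Z i) (idx_Z j) then 1 else 0.

Definition wedge11Z (al be : idx -> Z) : idx -> idx -> Z := fun i j =>
  (al i * be j - al j * be i)%Z.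
Definition wedge12Z (al : idx -> Z) (om : idx -> idx -> Z) : idx -> idx -> idx -> Z :=
  fun i j k => (al i * om j k - al j * om i k + al k * om i j)%Z.
Definition wedge22Z (a b : idx -> idx -> Z) : idx -> idx -> idx -> idx -> Z :=
  fun i j k l =>
  (a i j * b k l - a i k * b j l + a i l * b j k +
   a j k * b i l - a j l * b i k + a k l * b i j)%Z.

Definition omegaZ (l : idx3) : idx -> idx -> Z := fun i j =>
  match l with
  | u1 => wedge11Z (deltaZ i4) (deltaZ i7) i j + wedge11Z (deltaZ i5) (deltaZ i6) i j
  | u2 => wedge11Z (deltaZ i4) (deltaZ i6) i j - wedge11Z (deltaZ i5) (deltaZ i7) i j
  | u3 => wedge11Z (deltaZ i4) (deltaZ i5) i j + wedge11Z (deltaZ i6) (deltaZ i7) i j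
  end%Z.

(** The Hodge dual of e^l inside the three horizontal directions. *)
Definition hor_dualZ (l : idx3) : idx -> idx -> Z :=
  match l with
  | u1 => wedge11Z (deltaZ i2) (deltaZ i3)
  | u2 => wedge11Z (deltaZ i3) (deltaZ i1)
  | u3 => wedge11Z (deltaZ i1) (deltaZ i2)
  end.

Lemma zscal_opp (z : Z) (x : R) : zscal (- z) x = - zscal z x.
Proof. rewrite <- !zscalE, opp_IZR. ring. Qed.

Lemma wedge11_IZR (al be : tensor1) (al' be' : idx -> Z) :
  (forall i, al i = IZR (al' i)) -> (forall i, be i = IZR (be' i)) ->
  forall i j, wedge11 al be i j = IZR (wedge11Z al' be' i j).
Proof.
intros Ha Hb i j; unfold wedge11, wedge11Z.
now rewrite !Ha, !Hb, minus_IZR, !mult_IZR.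
Qed.

Lemma wedge12_IZR (al : tensor1) (om : tensor2) (al' : idx -> Z) (om' : idx -> idx -> Z) :
  (forall i, al i = IZR (al' i)) -> (forall i j, om i j = IZR (om' i j)) ->
  forall i j k, wedge12 al om i j k = IZR (wedge12Z al' om' i j k).
Proof.
intros Ha Ho i j k; unfold wedge12, wedge12Z.
now rewrite !Ha, !Ho, plus_IZR, minus_IZR, !mult_IZR.
Qed.

Lemma delta_IZR (i j : idx) : delta i j = IZR (deltaZ i j).
Proof. unfold delta, deltaZ. now destruct (Z.eqb _ _). Qed.

Lemma omega_IZR (l : idx3) (i j : idx) : omega delta l i j = IZR (omegaZ l i j).
Proof.
destruct l; unfold omega, omegaZ; rewrite ?minus_IZR, ?plus_IZR; f_equal;
  apply wedge11_IZR; apply delta_IZR.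
Qed.

Definition PhiZ (r : R) (h : H) : tensor3 := fun a b c =>
  zscal (wedge12Z (deltaZ i1) (wedge11Z (deltaZ i2) (deltaZ i3)) a b c) (r ^ 3) +
  sum3 (fun i => sum3 (fun l =>
    zscal (wedge12Z (deltaZ (hor l)) (omegaZ i) a b c) (Upsilon h i l))).

Lemma sum3_ext (F G : idx3 -> R) : (forall l, F l = G l) -> sum3 F = sum3 G.
Proof. intros E; unfold sum3; now rewrite !E. Qed.

Lemma wedge12_omega_IZR (a : idx) (l : idx3) (i j k : idx) :
  wedge12 (delta a) (omega delta l) i j k = IZR (wedge12Z (deltaZ a) (omegaZ l) i j k).
Proof. apply wedge12_IZR; [apply delta_IZR|apply omega_IZR]. Qed.

Lemma wedge111_IZR (a b c i j k : idx) :
  wedge12 (delta a) (wedge11 (delta b) (delta c)) i j k =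
  IZR (wedge12Z (deltaZ a) (wedge11Z (deltaZ b) (deltaZ c)) i j k).
Proof. apply wedge12_IZR; [|apply wedge11_IZR]; apply delta_IZR. Qed.

Lemma PhiE (r : R) (h : H) : Phi r h = PhiZ r h.
Proof.
do 3 (apply functional_extensionality; intros ?). unfold Phi, PhiZ.
rewrite wedge111_IZR, zscalE. f_equal.
apply sum3_ext; intros i. apply sum3_ext; intros l.
now rewrite wedge12_omega_IZR, zscalE.
Qed.

(** The dual 4-form in closed form. Unit covectors are r e^l horizontally and r^(-1/2) e^v
    vertically, so four vertical factors give r^(-2), and two of each kind give r^2 r^(-1) = r. *)
Definition Psi (r : R) (h : H) : tensor4 := fun i j k l =>
  zscal (wedge22Z (wedge11Z (deltaZ i4) (deltaZ i5)) (wedge11Z (deltaZ i6) (deltaZ i7))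
           i j k l) ((/ r) ^ 2)
  + r * sum3 (fun a => sum3 (fun b =>
      zscal (wedge22Z (hor_dualZ b) (omegaZ a) i j k l) (Upsilon h a b))).

Lemma alt4_wedge22Z (a b : idx -> idx -> Z) (x : R) :
  (forall i j, a i j = - a j i)%Z -> (forall i j, b i j = - b j i)%Z ->
  alt4 (fun i j k l => zscal (wedge22Z a b i j k l) x).
Proof.
intros Ha Hb. split; [intros i j k l|intros i; split; intros j k l];
  rewrite <- zscal_opp; f_equal; unfold wedge22Z.
- rewrite (Ha j i), (Hb j i). ring.
- rewrite (Ha k j), (Hb k j). ring.
- rewrite (Ha l k), (Hb l k). ring.
Qed.

Lemma wedge11Z_swap (al be : idx -> Z) (i j : idx) :
  (wedge11Z al be i j = - wedge11Z al be j i)%Z.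
Proof. unfold wedge11Z; ring. Qed.

Lemma omegaZ_swap (l : idx3) (i j : idx) : (omegaZ l i j = - omegaZ l j i)%Z.
Proof. destruct l; unfold omegaZ, wedge11Z; ring. Qed.

Lemma hor_dualZ_swap (l : idx3) (i j : idx) : (hor_dualZ l i j = - hor_dualZ l j i)%Z.
Proof. destruct l; apply wedge11Z_swap. Qed.

Lemma alt4_Psi (r : R) (h : H) : alt4 (Psi r h).
Proof.
apply (alt4_plus (fun i j k l => zscal _ _) (fun i j k l => _ * _)).
- apply alt4_wedge22Z; intros; apply wedge11Z_swap.
- apply alt4_scal.
  apply (alt4_sum3 (fun a i j k l => sum3 _)); intros a.
  apply (alt4_sum3 (fun b i j k l => zscal _ _)); intros b.
  apply alt4_wedge22Z; intros; [apply hor_dualZ_swap|apply omegaZ_swap].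
Qed.

Definition wt (r : R) (i : idx) : R :=
  match i with i1 | i2 | i3 => r ^ 2 | _ => / r end.
Definition wt_inv (r : R) (i : idx) : R :=
  match i with i1 | i2 | i3 => (/ r) ^ 2 | _ => r end.

(** The volume coefficient is r^3 (r^(-1/2))^4 = r. *)
Definition metric_r (r : R) : metric :=
  Metric (fun i j => wt r i * delta i j) (fun i j => wt_inv r i * delta i j) r.

Lemma sgn_swap (x y : Z) : Z.sgn (x - y) = (- Z.sgn (y - x))%Z.
Proof. rewrite <- Z.sgn_opp. f_equal; ring. Qed.

Lemma alt4_eps7 (a b c : idx) : alt4 (eps7 a b c).
Proof.
split; [intros i j k l|intros i; split; intros j k l];
  unfold eps7; rewrite <- opp_IZR; f_equal; cbn [map eps fold_right].
- rewrite (sgn_swap (idx_Z j) (idx_Z i)). ring.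
- rewrite (sgn_swap (idx_Z k) (idx_Z j)). ring.
- rewrite (sgn_swap (idx_Z l) (idx_Z k)). ring.
Qed.

(** [star] for a diagonal metric: raising an index is multiplication by a weight, which leaves 7^3
    terms out of 7^6. *)
Definition star_r (r : R) (phi : tensor3) : tensor4 := fun j k l m =>
  / 6 * r * (Sum a, wt_inv r a * (Sum b, wt_inv r b * (Sum c, (wt_inv r c * phi a b c) *
      eps7 a b c j k l m))).

Lemma starE (r : R) (phi : tensor3) (j k l m : idx) :
  star (metric_r r) phi j k l m = star_r r phi j k l m.
Proof.
unfold star, star_r. rewrite Rmult_assoc. f_equal. rewrite <- sum7_mult_l.
apply sum7_ext; intros a. rewrite <- !sum7_mult_l.
apply sum7_ext; intros b. rewrite <- !sum7_mult_l.
apply sum7_ext; intros c.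
assert (E : forall (F : idx -> R) x, (Sum y, Defs.up (metric_r r) x y * F y) = wt_inv r x * F x).
{ intros F x. rewrite <- (sum7_delta (fun y => wt_inv r x * F y)).
  apply sum7_ext; intros y. unfold metric_r; simpl. rewrite (delta_sym x). ring. }
transitivity ((wt_inv r a * (wt_inv r b * (wt_inv r c * phi a b c))) *
              (r * eps7 a b c j k l m)); [|ring].
f_equal.
rewrite <- (E (phi a b)),
  <- (E (fun b' => Sum c', Defs.up (metric_r r) c c' * phi a b' c')),
  <- (E (fun a' => Sum b', Defs.up (metric_r r) b b' *
            (Sum c', Defs.up (metric_r r) c c' * phi a' b' c'))).
apply sum7_ext; intros a'.
rewrite <- !sum7_mult_l. apply sum7_ext; intros b'.
rewrite <- !sum7_mult_l. apply sum7_ext; intros c'. ring.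
Qed.

Lemma alt4_star (r : R) (phi : tensor3) : alt4 (star_r r phi).
Proof.
unfold star_r. apply alt4_scal.
apply alt4_sum; intros a. apply alt4_sum; intros b. apply alt4_sum; intros c.
apply alt4_eps7.
Qed.

Lemma star_Phi (r : R) (h : H) : 0 < r -> star (metric_r r) (Phi r h) = Psi r h.
Proof.
intros Hr.
do 4 (apply functional_extensionality; intros ?).
rewrite starE. revert x x0 x1 x2. apply alt4_ext; [apply alt4_star|apply alt4_Psi|].
assert (Hi : r * / r = 1) by (field; lra).
intros i j k l Hij Hjk Hkl.
assert (E : star_r r (Phi r h) i j k l =
  / 6 * r * (Sum a, wt_inv r a * (Sum b, wt_inv r b * (Sum c,
    zscal (eps (map idx_Z [a; b; c; i; j; k; l])) (wt_inv r c * Phi r h a b c))))).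
{ unfold star_r. f_equal. apply sum7_ext; intros a. f_equal.
  apply sum7_ext; intros b. f_equal. apply sum7_ext; intros c. apply zscalE. }
rewrite E; clear E.
pose proof (alt3_Phi r h) as [P1 P2].
assert (P3 : forall i j k, Phi r h i j k = - Phi r h k j i).
{ intros. rewrite P1, P2, P1. ring. }
assert (P4 : forall i j k, Phi r h i j k = Phi r h k i j).
{ intros. rewrite P2, P1. ring. }
assert (P5 : forall i j k, Phi r h i j k = Phi r h j k i).
{ intros. rewrite P1, P2. ring. }
destruct i, j; try discriminate Hij; destruct k; try discriminate Hjk;
  destruct l; try discriminate Hkl;
  cbv -[Rplus Rmult Rminus Ropp Rinv IZR wt_inv Phi Psi];
  (* The surviving terms are the six orderings of the triple complementary to i, j, k, l; they are
     equal, which cancels the factor [/ 6]. *)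
  match goal with
  | |- context [_ + _ * Phi r h ?a ?b ?c] =>
      rewrite (P1 b a c), (P2 a c b), (P3 c b a), (P4 b c a), (P5 c a b);
      transitivity (r * (wt_inv r a * wt_inv r b * wt_inv r c * Phi r h a b c)); [field|]
  end;
  rewrite PhiE; cbv -[Rplus Rmult Rminus Ropp Rinv IZR Upsilon pow];
  (* With [/ r] generalised to a variable, what remains is a polynomial identity modulo
     [r * ri = 1]. *)
  set (ri := / r) in *; clearbody ri; ring [Hi].
Qed.

(** * The Levi-Civita connection *)

Definition to_idx3 (i : idx) : option idx3 :=
  match i with i1 => Some u1 | i2 => Some u2 | i3 => Some u3 | _ => None end.

Definition sign3 (l : idx3) : R := match l with u2 => -1 | _ => 1 end.

(** The structure constants of p form the 3-form 2 e^123 + e^1 /\ omega_1 - e^2 /\ omega_2 + e^3 /\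
    omega_3. They are totally skew because the inner product is Ad-invariant. *)
Definition bracket_form (i j k : idx) : R :=
  zscal (wedge12Z (deltaZ i1) (wedge11Z (deltaZ i2) (deltaZ i3)) i j k) 2 +
  sum3 (fun l => zscal (wedge12Z (deltaZ (hor l)) (omegaZ l) i j k) (sign3 l)).

Lemma bracket_pE (i j k : idx) : bracket_p i j k = bracket_form i j k.
Proof.
assert (Hs : / sqrt 2 * / sqrt 2 = / 2).
{ rewrite <- Rinv_mult, sqrt_sqrt; lra. }
destruct i, j, k;
  cbv [bracket_p bracket inner mmul madd mstar mscal e m11 m12 m21 m22
       qadd qmul qconj qscal q_zero q_one q_i q_j q_k q0 q1 q2 q3 fst snd];
  cbv -[Rplus Rmult Rminus Ropp Rinv IZR sqrt];
  set (s := / sqrt 2) in *; clearbody s; lra.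
Qed.

(* By the Koszul formula the coefficient of the totally skew bracket is
   [(1 + (w j - w i) / w k) / 2], with [w := wt r] the squared lengths of the frame. *)
Definition lc_tensor (r : R) : tensor3 := fun i j k =>
  match to_idx3 i, to_idx3 j with
  | Some _, None => 1 - r ^ 3 * / 2
  | None, Some _ => r ^ 3 * / 2
  | _, _ => / 2
  end * bracket_form i j k.

(** For the torsion, the coefficients of (i, j) and (j, i) add up to 1. For compatibility with the
    metric, the coefficient of (i, j) times the weight of k is symmetric in j and k wherever the
    skew form is nonzero. *)
Lemma levi_civita_metric_r (r : R) : 0 < r -> levi_civita (metric_r r) (lc_tensor r).
Proof.
intros Hr; split; intros i j k.
- rewrite bracket_pE.
  destruct i, j, k; cbv -[Rplus Rmult Rminus Ropp Rinv IZR pow]; lra.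
- assert (E : forall F G, (Sum m, F m * lo (metric_r r) m k + G m * lo (metric_r r) j m) =
                          F k * wt r k + G j * wt r j).
  { intros F G; rewrite sum7_plus; f_equal.
    - rewrite <- (sum7_delta (fun m => F m * wt r m)).
      apply sum7_ext; intros m; unfold metric_r; simpl; ring.
    - rewrite <- (sum7_delta (fun m => G m * wt r j)).
      apply sum7_ext; intros m; unfold metric_r; simpl; rewrite (delta_sym j); ring. }
  rewrite E; clear E.
  destruct i, j, k;
    cbv -[Rplus Rmult Rminus Ropp Rinv IZR pow];
    try lra; field; lra.
Qed.

(** * Torsion and its divergence *)

(* Solved from [nabla_i phi_jkl = T_i^m psi_mjkl] by the contraction
   [psi_mjkl psi_n^jkl = 24 g_mn]. *)
Definition torsion_Phi (r : R) (h : H) : tensor2 := fun i j =>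
  match to_idx3 i, to_idx3 j with
  | Some a, Some b => r * (r ^ 3 - 2) * sign3 a * Upsilon h a b - zscal (deltaZ i j) r
  | None, None =>
      r * (zscal (deltaZ i j) (2 * q2 h ^ 2 - / 2) +
           2 * q2 h * (zscal (omegaZ u3 i j) (q1 h) + zscal (omegaZ u2 i j) (q0 h)
                       - zscal (omegaZ u1 i j) (q3 h)))
  | _, _ => 0
  end.

Lemma sum7_up (r : R) (F : idx -> R) (m : idx) :
  (Sum n, F n * Defs.up (metric_r r) n m) = F m * wt_inv r m.
Proof.
rewrite <- (sum7_delta (fun n => F n * wt_inv r n)).
apply sum7_ext; intros n. unfold metric_r; simpl. ring.
Qed.

Lemma full_torsion_Phi (r : R) (h : H) :
  0 < r -> Sp1 h -> full_torsion (Phi r h) (metric_r r) (lc_tensor r) (torsion_Phi r h).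
Proof.
intros Hr Hh i.
assert (Hi : r * / r = 1) by (field; lra).
apply (alt3_ext (nabla3 (lc_tensor r) (Phi r h) i)
  (fun j k l => Sum m, (Sum n, torsion_Phi r h i n * Defs.up (metric_r r) n m) *
                      star (metric_r r) (Phi r h) m j k l)).
- apply alt3_nabla3, alt3_Phi.
- apply alt3_sum. intros m. rewrite star_Phi by easy. apply alt4_Psi.
- intros j k l Hjk Hkl. rewrite star_Phi by easy.
  transitivity (Sum m, torsion_Phi r h i m * wt_inv r m * Psi r h m j k l);
    [|apply sum7_ext; intros m; now rewrite sum7_up].
  rewrite PhiE. destruct h as [[[h0 h1] h2] h3].
  change (h0 ^ 2 + h1 ^ 2 + h2 ^ 2 + h3 ^ 2 = 1) in Hh.
  assert (Hh' : h0 ^ 2 = 1 - h1 ^ 2 - h2 ^ 2 - h3 ^ 2) by lra.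
  assert (Hf : 2 * / 2 = 1) by lra.
  destruct j, k; try discriminate Hjk; destruct l; try discriminate Hkl;
    destruct i;
    abstract (cbv -[Rplus Rmult Rminus Ropp Rinv IZR pow];
      set (ri := / r) in *; clearbody ri; set (hf := / 2) in *; clearbody hf;
      ring [Hh' Hi Hf]).
Qed.

Definition div_coef (r : R) (h : H) (j : idx) : R :=
  4 * (r ^ 3 + 2) * (r ^ 3 - 1) * q2 h * / r *
  match j with i1 => - q3 h | i2 => - q0 h | i3 => q1 h | _ => 0 end.

Lemma divT_Phi (r : R) (h : H) (j : idx) : 0 < r -> Sp1 h ->
  divT (metric_r r) (lc_tensor r) (torsion_Phi r h) j = div_coef r h j.
Proof.
intros Hr Hh.
assert (Hi : r * / r = 1) by (field; lra).
transitivity (Sum i, nabla2 (lc_tensor r) (torsion_Phi r h) i i j * wt_inv r i).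
{ apply sum7_ext; intros i.
  rewrite <- (sum7_up r (fun k => nabla2 (lc_tensor r) (torsion_Phi r h) k i j)).
  apply sum7_ext; intros k. rewrite Rmult_comm. f_equal.
  destruct i, k; cbv -[Rplus Rmult Rinv IZR]; ring. }
destruct h as [[[h0 h1] h2] h3].
change (h0 ^ 2 + h1 ^ 2 + h2 ^ 2 + h3 ^ 2 = 1) in Hh.
assert (Hh' : h0 ^ 2 = 1 - h1 ^ 2 - h2 ^ 2 - h3 ^ 2) by lra.
assert (Hf : 2 * / 2 = 1) by lra.
unfold nabla2.
destruct j; cbv -[Rplus Rmult Rminus Ropp Rinv IZR pow];
  set (ri := / r) in *; clearbody ri; set (hf := / 2) in *; clearbody hf;
  ring [Hh' Hi Hf].
Qed.

(** * The G_2-structures *)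

(* Reading [e_4, ..., e_7] as [i, j, k, 1], [Ad h] is left multiplication by [h]. *)
Definition qvert (i : idx) : H :=
  match i with i4 => q_i | i5 => q_j | i6 => q_k | _ => q_one end.
Definition qcoord (i : idx) (q : H) : R :=
  match i with i4 => q1 q | i5 => q2 q | i6 => q3 q | _ => q0 q end.

Lemma Ad_pE (h : H) (i k : idx) :
  Ad_p h i k =
  match to_idx3 i, to_idx3 k with
  | Some _, Some _ => delta i k
  | None, None => qcoord k (qmul h (qvert i))
  | _, _ => 0
  end.
Proof.
assert (Hs : / sqrt 2 * / sqrt 2 = / 2).
{ rewrite <- Rinv_mult, sqrt_sqrt; lra. }
destruct h as [[[h0 h1] h2] h3].
(* These instances make the products of [/ sqrt 2 * / sqrt 2] with the components of h linear for
   [lra]. *)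
assert (K : forall x, / sqrt 2 * / sqrt 2 * x = / 2 * x) by (intros; now rewrite Hs).
pose proof (K h0). pose proof (K h1). pose proof (K h2). pose proof (K h3).
destruct i, k;
  abstract (cbv -[Rplus Rmult Rminus Ropp Rinv IZR pow sqrt];
    set (s := / sqrt 2) in *; clearbody s; lra).
Qed.

(** Pulling back along f replaces every e^a in [Phi] by [f a]; it is used for the coframe moved by
    Ad. *)
Lemma Phi_contract (r : R) (h : H) (f : idx -> tensor1) (i j k : idx) :
  (Sum a, Sum b, Sum c, f a i * f b j * f c k * Phi r h a b c) =
  r ^ 3 * wedge12 (f i1) (wedge11 (f i2) (f i3)) i j k +
  sum3 (fun a => sum3 (fun l => Upsilon h a l * wedge12 (f (hor l)) (omega f a) i j k)).
Proof.
rewrite PhiE. cbv -[Rplus Rmult Rminus Ropp Rinv IZR Upsilon pow]. ring.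
Qed.

(** Ad fixes the horizontal covectors. On the vertical quaternions it is left multiplication by a
    unit, whereas each omega_l is, up to sign, (x, y) -> <x q, y> with q one of i, j, k; left and
    right multiplications commute, so omega_l is preserved. *)
Lemma Ad_invariant_Phi (r : R) (h : H) : Ad_invariant (Phi r h).
Proof.
intros k Hk x y z.
rewrite (Phi_contract r h (fun a i => Ad_p k i a)).
assert (Eh : forall l, (fun i => Ad_p k i (hor l)) = delta (hor l)).
{ intros l; apply functional_extensionality; intros i.
  rewrite Ad_pE. destruct l, i; reflexivity. }
assert (Ev : forall l i j, omega (fun a i => Ad_p k i a) l i j = omega delta l i j).
{ intros l i j. unfold omega, wedge11. rewrite !Ad_pE.
  destruct k as [[[h0 h1] h2] h3].
  change (h0 ^ 2 + h1 ^ 2 + h2 ^ 2 + h3 ^ 2 = 1) in Hk.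
  assert (Hh' : h0 ^ 2 = 1 - h1 ^ 2 - h2 ^ 2 - h3 ^ 2) by lra.
  destruct l, i, j;
    abstract (cbv -[Rplus Rmult Rminus Ropp Rinv IZR pow]; ring [Hh']). }
pose proof (Eh u1) as E1. pose proof (Eh u2) as E2. pose proof (Eh u3) as E3.
simpl in E1, E2, E3. rewrite E1, E2, E3.
unfold Phi. f_equal. apply sum3_ext; intros a. apply sum3_ext; intros l.
rewrite Eh. unfold wedge12. now rewrite !Ev.
Qed.

(** The horizontal covectors are rotated by [Upsilon h] and scaled by r, the vertical ones scaled by
    r^(-1/2). The rotation drops out of the metric and of the volume. *)
Definition coframe (r : R) (h : H) (a i : idx) : R :=
  match to_idx3 a, to_idx3 i with
  | Some b, Some l => r * Upsilon h b l
  | None, None => zscal (deltaZ a i) (/ sqrt r)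
  | _, _ => 0
  end.

Lemma sum7_at (F : idx -> R) (j : idx) : (forall i, i <> j -> F i = 0) -> sum7 F = F j.
Proof.
intros E. rewrite <- (sum7_delta F). apply sum7_ext; intros i.
unfold delta. destruct (Z.eqb_spec (idx_Z i) (idx_Z j)) as [D|D]; [ring|].
rewrite E; [ring|]. now intros ->.
Qed.

(** The value is r^3 det(Upsilon) (r^(-1/2))^4 with det(Upsilon) = 1. Each vertical row has a single
    nonzero entry, so four of the seven sums collapse before anything is expanded. *)
Lemma det7_coframe (r : R) (h : H) : 0 < r -> Sp1 h -> det7 (coframe r h) = r.
Proof.
intros Hr Hh.
assert (E : forall a i, to_idx3 a = None -> i <> a -> coframe r h a i = 0).
{ intros a i Ha Hi. unfold coframe. rewrite Ha.
  destruct a; try discriminate Ha; destruct i; easy || now destruct Hi. }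
set (f := coframe r h).
set (G := fun a b c j k l m => eps7 a b c j k l m *
    (f i1 a * f i2 b * f i3 c * f i4 j * f i5 k * f i6 l * f i7 m)).
transitivity (Sum a, Sum b, Sum c, G a b c i4 i5 i6 i7).
{ transitivity (Sum a, Sum b, Sum c, Sum j, Sum k, Sum l, G a b c j k l i7).
  { do 6 (apply sum7_ext; intros ?). apply (sum7_at (fun m => G _ _ _ _ _ _ m)).
    intros m Hm. unfold G, f. rewrite (E i7 m) by easy. ring. }
  transitivity (Sum a, Sum b, Sum c, Sum j, Sum k, G a b c j k i6 i7).
  { do 5 (apply sum7_ext; intros ?). apply (sum7_at (fun l => G _ _ _ _ _ l i7)).
    intros m Hm. unfold G, f. rewrite (E i6 m) by easy. ring. }
  transitivity (Sum a, Sum b, Sum c, Sum j, G a b c j i5 i6 i7).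
  { do 4 (apply sum7_ext; intros ?). apply (sum7_at (fun k => G _ _ _ _ k i6 i7)).
    intros m Hm. unfold G, f. rewrite (E i5 m) by easy. ring. }
  do 3 (apply sum7_ext; intros ?). apply (sum7_at (fun j => G _ _ _ j i5 i6 i7)).
  intros m Hm. unfold G, f. rewrite (E i4 m) by easy. ring. }
transitivity (Sum a, Sum b, Sum c,
  zscal (eps (map idx_Z [a; b; c; i4; i5; i6; i7]))
    (f i1 a * f i2 b * f i3 c * f i4 i4 * f i5 i5 * f i6 i6 * f i7 i7)).
{ do 3 (apply sum7_ext; intros ?). rewrite <- zscalE. apply Rmult_comm. }
unfold f.
assert (Hs : / sqrt r * / sqrt r = / r).
{ rewrite <- Rinv_mult, sqrt_sqrt; lra. }
assert (Hi : r * / r = 1) by (field; lra).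
destruct h as [[[h0 h1] h2] h3].
change (h0 ^ 2 + h1 ^ 2 + h2 ^ 2 + h3 ^ 2 = 1) in Hh.
assert (Hh' : h0 ^ 2 = 1 - h1 ^ 2 - h2 ^ 2 - h3 ^ 2) by lra.
cbv -[Rplus Rmult Rminus Ropp Rinv IZR pow sqrt];
  set (s := / sqrt r) in *; clearbody s; set (ri := / r) in *; clearbody ri;
  ring [Hs Hi Hh'].
Qed.

Lemma induces_Phi (r : R) (h : H) : 0 < r -> Sp1 h -> induces (Phi r h) (metric_r r).
Proof.
intros Hr Hh. exists (coframe r h).
split; [|split; [|split]].
4: now rewrite det7_coframe.
3: { intros i j. transitivity (Sum k, (lo (metric_r r) i k * wt_inv r k) * delta k j).
  { apply sum7_ext; intros k; unfold metric_r; simpl; ring. }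
  rewrite sum7_delta. unfold metric_r; simpl.
  destruct i, j; cbv -[Rplus Rmult Rinv IZR pow]; field; lra. }
all: assert (Hs : / sqrt r * / sqrt r = / r)
  by (rewrite <- Rinv_mult, sqrt_sqrt; lra).
all: assert (Hi : r * / r = 1) by (field; lra).
2: {
  intros i j. destruct h as [[[h0 h1] h2] h3].
  change (h0 ^ 2 + h1 ^ 2 + h2 ^ 2 + h3 ^ 2 = 1) in Hh.
  assert (Hh' : h0 ^ 2 = 1 - h1 ^ 2 - h2 ^ 2 - h3 ^ 2) by lra.
  destruct i, j;
    abstract (cbv -[Rplus Rmult Rminus Ropp Rinv IZR pow sqrt];
      set (s := / sqrt r) in *; clearbody s; set (ri := / r) in *; clearbody ri;
      ring [Hs Hi Hh']). }
apply alt3_ext; [apply alt3_Phi| |].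
- apply (alt3_plus (wedge12 _ _) (fun i j k => sum3 _)); [apply alt3_wedge|].
  apply (alt3_sum3 (fun l => wedge12 _ _)); intros l; apply alt3_wedge_omega.
- intros i j k Hij Hjk. rewrite PhiE. destruct h as [[[h0 h1] h2] h3].
  change (h0 ^ 2 + h1 ^ 2 + h2 ^ 2 + h3 ^ 2 = 1) in Hh.
  assert (Hh' : h0 ^ 2 = 1 - h1 ^ 2 - h2 ^ 2 - h3 ^ 2) by lra.
  destruct i, j; try discriminate Hij; destruct k; try discriminate Hjk;
    abstract (cbv -[Rplus Rmult Rminus Ropp Rinv IZR pow sqrt];
      set (s := / sqrt r) in *; clearbody s; set (ri := / r) in *; clearbody ri;
      ring [Hs Hi Hh']).
Qed.

Lemma G2_structure_Phi (r : R) (h : H) :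
  0 < r -> Sp1 h -> G2_structure (Phi r h) (metric_r r).
Proof. intros; split; [apply Ad_invariant_Phi|now apply induces_Phi]. Qed.

(** * Coclosed structures *)

Lemma alt3_bracket_form : alt3 bracket_form.
Proof.
apply (alt3_plus (fun i j k => zscal _ _) (fun i j k => sum3 _)).
- split; intros; rewrite <- zscal_opp; f_equal; unfold wedge12Z, wedge11Z; ring.
- apply (alt3_sum3 (fun l i j k => zscal _ _)); intros l.
  split; intros; rewrite <- zscal_opp; f_equal; unfold wedge12Z.
  + rewrite (omegaZ_swap l j i). ring.
  + rewrite (omegaZ_swap l k j). ring.
Qed.

(** An adjacent transposition permutes the ten terms up to sign; the term that brackets the two
    swapped arguments changes sign by skewness of the bracket. *)
Lemma alt5_d4 (psi : tensor4) : alt4 psi -> alt5 (d4 psi).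
Proof.
intros H4.
set (B := fun x y p q s => Sum n, bracket_p x y n * psi n p q s).
assert (B1 : forall x y p q s, B x y p q s = - B y x p q s).
{ intros. unfold B. rewrite <- sum7_opp. apply sum7_ext; intros n.
  rewrite !bracket_pE, (proj1 alt3_bracket_form x y). ring. }
assert (B2 : forall x y, alt3 (B x y)).
{ intros x y. apply alt3_sum. intros n. apply H4. }
assert (B3 : forall x y p q s, B x y p q s = - B x y q p s)
  by (intros x y; apply (B2 x y)).
assert (B4 : forall x y p q s, B x y p q s = - B x y p s q)
  by (intros x y; apply (B2 x y)).
assert (E : forall i j k l m, d4 psi i j k l m =
    - B i j k l m + B i k j l m - B i l j k m + B i m j k l
    - B j k i l m + B j l i k m - B j m i k l
    - B k l i j m + B k m i j l - B l m i j k) by reflexivity.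
split; [intros i j k l m|intros i; split; [intros j k l m|
  intros j; split; [intros k l m|intros k l m]]]; rewrite !E.
- rewrite (B1 j i), (B3 k l j i), (B3 k m j i), (B3 l m j i). ring.
- rewrite (B1 k j), (B3 i l k j), (B3 i m k j), (B4 l m i k j). ring.
- rewrite (B1 l k), (B3 i j l k), (B4 i m j l k), (B4 j m i l k). ring.
- rewrite (B1 m l), (B4 i j k m l), (B4 i k j m l), (B4 j k i m l). ring.
Qed.

(** The skew part of [torsion_Phi] consists of multiples of h_2 h_0, h_2 h_1 and h_2 h_3, and a
    G_2-structure is coclosed when its torsion is symmetric. The proof checks d psi = 0 on
    components. *)
Lemma coclosed_Phi (r : R) (h : H) : 0 < r -> Sp1 h ->
  q2 h = 0 \/ (q0 h = 0 /\ q1 h = 0 /\ q3 h = 0) -> coclosed (Phi r h).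
Proof.
intros Hr Hh Hc. exists (metric_r r). split; [now apply G2_structure_Phi|].
rewrite star_Phi by easy.
assert (Hi : r * / r = 1) by (field; lra).
apply alt5_zero; [apply alt5_d4, alt4_Psi|].
intros i j k l m Hij Hjk Hkl Hlm.
assert (HB : bracket_p = bracket_form)
  by (do 3 (apply functional_extensionality; intros ?); apply bracket_pE).
unfold d4; rewrite HB. destruct h as [[[h0 h1] h2] h3].
change (h0 ^ 2 + h1 ^ 2 + h2 ^ 2 + h3 ^ 2 = 1) in Hh.
assert (Hh' : h0 ^ 2 = 1 - h1 ^ 2 - h2 ^ 2 - h3 ^ 2) by lra.
change (h2 = 0 \/ h0 = 0 /\ h1 = 0 /\ h3 = 0) in Hc.
destruct i, j; try discriminate Hij; destruct k; try discriminate Hjk;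
  destruct l; try discriminate Hkl; destruct m; try discriminate Hlm;
  abstract (cbv -[Rplus Rmult Rminus Ropp Rinv IZR pow];
    set (ri := / r) in *; clearbody ri;
    (destruct Hc as [H2|(H0 & H1 & H3)]; [ring [H2]|ring [H0 H1 H3]])).
Qed.

(** * Derivatives and limits in H *)

Lemma is_derive_pair {U V : NormedModule R_AbsRing} (f : R -> U) (g : R -> V) x lf lg :
  is_derive f x lf -> is_derive g x lg ->
  is_derive (fun t => (f t, g t)) x (lf, lg).
Proof.
intros Hf Hg.
apply (filterdiff_comp_2 f g (fun u v => (u, v)) (fun y => scal y lf)
         (fun y => scal y lg) (fun u v => (u, v)) Hf Hg).
apply filterdiff_linear, is_linear_prod; [apply is_linear_fst|apply is_linear_snd].
Qed.

Lemma is_derive_fst {U V : NormedModule R_AbsRing} (f : R -> U * V) x l :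
  is_derive f x l -> is_derive (fun t => fst (f t)) x (fst l).
Proof.
intros Hf.
apply (filterdiff_comp f fst (fun y => scal y l) fst); [easy|].
apply filterdiff_linear, is_linear_fst.
Qed.

Lemma is_derive_snd {U V : NormedModule R_AbsRing} (f : R -> U * V) x l :
  is_derive f x l -> is_derive (fun t => snd (f t)) x (snd l).
Proof.
intros Hf.
apply (filterdiff_comp f snd (fun y => scal y l) snd); [easy|].
apply filterdiff_linear, is_linear_snd.
Qed.

Lemma is_derive_H (m : R -> H) (t : R) (v : H) :
  is_derive m t v <->
  is_derive (fun s => q0 (m s)) t (q0 v) /\ is_derive (fun s => q1 (m s)) t (q1 v) /\
  is_derive (fun s => q2 (m s)) t (q2 v) /\ is_derive (fun s => q3 (m s)) t (q3 v).
Proof.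
split.
- intros D. split; [|split; [|split]].
  + exact (is_derive_fst _ _ _ (is_derive_fst _ _ _ (is_derive_fst _ _ _ D))).
  + exact (is_derive_snd _ _ _ (is_derive_fst _ _ _ (is_derive_fst _ _ _ D))).
  + exact (is_derive_snd _ _ _ (is_derive_fst _ _ _ D)).
  + exact (is_derive_snd _ _ _ D).
- intros (D0 & D1 & D2 & D3).
  apply (is_derive_ext (fun s => (q0 (m s), q1 (m s), q2 (m s), q3 (m s)))).
  { intros s. now destruct (m s) as [[[x0 x1] x2] x3]. }
  destruct v as [[[v0 v1] v2] v3].
  now repeat apply is_derive_pair.
Qed.

Lemma filterlim_pair_locally {T : Type} {U V : UniformSpace} (F : (T -> Prop) -> Prop)
  {FF : Filter F} (f : T -> U) (g : T -> V) (x : U) (y : V) :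
  filterlim f F (locally x) -> filterlim g F (locally y) ->
  filterlim (fun t => (f t, g t)) F (locally (x, y)).
Proof.
intros Hf Hg P [d HP].
unfold filtermap.
apply (filter_imp (fun t => ball x d (f t) /\ ball y d (g t))).
- intros t [Bf Bg]. apply HP. now split.
- apply filter_and; [apply Hf|apply Hg]; now exists d.
Qed.

Lemma filterlim_H {T : Type} (F : (T -> Prop) -> Prop) {FF : Filter F} (m : T -> H) (h : H) :
  filterlim (fun s => q0 (m s)) F (locally (q0 h)) ->
  filterlim (fun s => q1 (m s)) F (locally (q1 h)) ->
  filterlim (fun s => q2 (m s)) F (locally (q2 h)) ->
  filterlim (fun s => q3 (m s)) F (locally (q3 h)) ->
  filterlim m F (locally h).
Proof.
intros. apply (filterlim_ext (fun s => (q0 (m s), q1 (m s), q2 (m s), q3 (m s)))).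
{ intros s. now destruct (m s) as [[[x0 x1] x2] x3]. }
destruct h as [[[h0 h1] h2] h3].
now repeat apply filterlim_pair_locally.
Qed.

(** The function f exp(- K t) is nonincreasing and f exp(K t) is nondecreasing, and both vanish at
    0. The first forces f <= 0 for t >= 0, the second for t < 0. *)
Lemma gronwall_zero (f g : R -> R) (K : R) :
  (forall t, 0 <= f t) -> f 0 = 0 ->
  (forall t, is_derive f t (g t)) -> (forall t, Rabs (g t) <= K * f t) ->
  forall t, f t = 0.
Proof.
intros Hf H0 Hg HK t.
assert (D : forall k s, is_derive (fun s => f s * exp (k * s)) s
                          ((g s + k * f s) * exp (k * s))).
{ intros k s. auto_derive; [now exists (g s)|].
  replace (Derive (fun x => f x) s) with (g s) by (symmetry; now apply is_derive_unique).
  ring. }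
assert (M : forall k, exists c, f t * exp (k * t) = (g c + k * f c) * exp (k * c) * t).
{ intros k.
  destruct (MVT_gen (fun s => f s * exp (k * s)) 0 t
              (fun s => (g s + k * f s) * exp (k * s))) as (c & _ & E).
  - intros; apply D.
  - intros s _. apply derivable_continuous_pt. eexists. apply is_derive_Reals, D.
  - exists c. rewrite H0 in E. lra. }
enough (exists k, f t * exp (k * t) <= 0) as [k Hk].
{ pose proof (Hf t). pose proof (exp_pos (k * t)). nra. }
destruct (Rle_dec 0 t) as [Ht|Ht].
- exists (- K). destruct (M (- K)) as [c ->].
  pose proof (exp_pos (- K * c)). pose proof (HK c) as B.
  apply Rabs_le_between in B.
  assert (0 <= (K * f c - g c) * exp (- K * c)) by (apply Rmult_le_pos; lra). nra.
- exists K. destruct (M K) as [c ->].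
  pose proof (exp_pos (K * c)). pose proof (HK c) as B.
  apply Rabs_le_between in B.
  assert (0 <= (g c + K * f c) * exp (K * c)) by (apply Rmult_le_pos; lra). nra.
Qed.

Lemma filterlim_exp_zero (k : R) (x : Rbar) :
  0 < k /\ x = m_infty \/ k < 0 /\ x = p_infty ->
  filterlim (fun t => exp (k * t)) (Rbar_locally x) (locally 0).
Proof.
intros Hk. apply (filterlim_comp _ _ _ (Rmult k) exp _ (Rbar_locally m_infty));
  [|apply is_lim_exp_m].
destruct Hk as [[Hk ->]|[Hk ->]]; intros P [M HM]; exists (M / k); intros t Ht; apply HM.
- apply (Rmult_lt_compat_l k) in Ht; [|easy].
  replace (k * (M / k)) with M in Ht by (field; lra). lra.
- apply (Rmult_lt_gt_compat_neg_l k) in Ht; [|easy].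
  replace (k * (M / k)) with M in Ht by (field; lra). lra.
Qed.

(** * The isometric flow *)

Lemma torsion_data_Phi (r : R) (h : H) : 0 < r -> Sp1 h ->
  torsion_data (Phi r h) (metric_r r) (lc_tensor r) (torsion_Phi r h).
Proof.
intros Hr Hh. split; [now apply G2_structure_Phi|].
split; [now apply levi_civita_metric_r|now apply full_torsion_Phi].
Qed.

(** Each case kills one factor of [div_coef]: r^3 - 1, h_2, or the vector (- h_3, - h_0, h_1). *)
Lemma harmonic_Phi (r : R) (h : H) : 0 < r -> Sp1 h ->
  r = 1 \/ q2 h = 0 \/ (q0 h = 0 /\ q1 h = 0 /\ q3 h = 0) -> harmonic (Phi r h).
Proof.
intros Hr Hh Hc. exists (metric_r r), (lc_tensor r), (torsion_Phi r h).
split; [now apply torsion_data_Phi|]. intros j. rewrite divT_Phi by easy.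
unfold div_coef.
destruct Hc as [->|[->|(-> & -> & ->)]]; [| |destruct j]; ring.
Qed.

Definition dUpsilon (h v : H) (i l : idx3) : R :=
  let h0 := q0 h in let h1 := q1 h in let h2 := q2 h in let h3 := q3 h in
  let v0 := q0 v in let v1 := q1 v in let v2 := q2 v in let v3 := q3 v in
  2 * match i, l with
  | u1, u1 => h0 * v0 + h1 * v1 - h2 * v2 - h3 * v3
  | u1, u2 => h1 * v2 + v1 * h2 - h0 * v3 - v0 * h3
  | u1, u3 => h1 * v3 + v1 * h3 + h0 * v2 + v0 * h2
  | u2, u1 => h1 * v2 + v1 * h2 + h0 * v3 + v0 * h3
  | u2, u2 => h0 * v0 - h1 * v1 + h2 * v2 - h3 * v3
  | u2, u3 => h2 * v3 + v2 * h3 - h0 * v1 - v0 * h1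
  | u3, u1 => h1 * v3 + v1 * h3 - h0 * v2 - v0 * h2
  | u3, u2 => h2 * v3 + v2 * h3 + h0 * v1 + v0 * h1
  | u3, u3 => h0 * v0 - h1 * v1 - h2 * v2 + h3 * v3
  end.

Lemma is_derive_Upsilon (m : R -> H) (t : R) (v : H) (i l : idx3) :
  is_derive m t v -> is_derive (fun s => Upsilon (m s) i l) t (dUpsilon (m t) v i l).
Proof.
intros D. apply is_derive_H in D as (D0 & D1 & D2 & D3).
unfold Upsilon, dUpsilon. cbv zeta.
set (f0 := fun s => q0 (m s)). set (f1 := fun s => q1 (m s)).
set (f2 := fun s => q2 (m s)). set (f3 := fun s => q3 (m s)).
destruct v as [[[v0 v1] v2] v3].
change (is_derive f0 t v0) in D0. change (is_derive f1 t v1) in D1.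
change (is_derive f2 t v2) in D2. change (is_derive f3 t v3) in D3.
change (q0 (m t)) with (f0 t). change (q1 (m t)) with (f1 t).
change (q2 (m t)) with (f2 t). change (q3 (m t)) with (f3 t).
apply (is_derive_ext (fun s => Upsilon (f0 s, f1 s, f2 s, f3 s) i l)); [reflexivity|].
clearbody f0 f1 f2 f3.
destruct i, l; unfold Upsilon; cbv zeta beta delta [q0 q1 q2 q3 fst snd]; cbv iota;
  auto_derive;
  try (repeat split; eexists; eassumption);
  repeat match goal with
  | |- context [Derive ?f t] =>
     first [rewrite (is_derive_unique f t _ D0)|rewrite (is_derive_unique f t _ D1)
           |rewrite (is_derive_unique f t _ D2)|rewrite (is_derive_unique f t _ D3)]
  end; ring.
Qed.

Definition dPhi (h v : H) : tensor3 := fun a b c =>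
  sum3 (fun i => sum3 (fun l =>
    zscal (wedge12Z (deltaZ (hor l)) (omegaZ i) a b c) (dUpsilon h v i l))).

Lemma alt3_dPhi (h v : H) : alt3 (dPhi h v).
Proof.
apply (alt3_sum3 (fun i a b c => sum3 _)); intros i.
apply (alt3_sum3 (fun l a b c => zscal _ _)); intros l.
split; intros; rewrite <- zscal_opp; f_equal; unfold wedge12Z.
- rewrite (omegaZ_swap i j i0). ring.
- rewrite (omegaZ_swap i k j). ring.
Qed.

Lemma is_derive_sum3 (f : idx3 -> R -> R) (t : R) (d : idx3 -> R) :
  (forall l, is_derive (f l) t (d l)) ->
  is_derive (fun s => sum3 (fun l => f l s)) t (sum3 d).
Proof.
intros D. unfold sum3.
apply (is_derive_plus (fun s => f u1 s + f u2 s) (f u3)); [|apply D].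
apply (is_derive_plus (f u1) (f u2)); apply D.
Qed.

Lemma is_derive_Phi (r : R) (m : R -> H) (t : R) (v : H) (a b c : idx) :
  is_derive m t v -> is_derive (fun s => Phi r (m s) a b c) t (dPhi (m t) v a b c).
Proof.
intros D. apply (is_derive_ext (fun s => PhiZ r (m s) a b c)).
{ intros s. now rewrite PhiE. }
unfold PhiZ, dPhi. rewrite <- (Rplus_0_l (sum3 _)).
match goal with |- is_derive (fun s => ?k + @?f s) t (0 + ?d) =>
  apply (is_derive_plus (fun _ => k) f t 0 d) end; [exact (is_derive_const _ t)|].
apply (is_derive_sum3 (fun i s => sum3 _)); intros i.
apply (is_derive_sum3 (fun l s => zscal _ _)); intros l.
apply (is_derive_ext
  (fun s => IZR (wedge12Z (deltaZ (hor l)) (omegaZ i) a b c) * Upsilon (m s) i l)).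
{ intros s. now rewrite Rmult_comm, zscalE. }
rewrite <- zscalE, Rmult_comm. apply is_derive_scal. now apply is_derive_Upsilon.
Qed.

(** Since div T is horizontal, its contraction with [Psi] loses the e^4567 term and lies in the span
    of the e^l /\ omega_a, as does the derivative of [Phi r (m t)]. So the flow moves [Upsilon]
    only. *)
Lemma isometric_flow_Phi (r : R) (m : R -> H) : 0 < r -> (forall t, Sp1 (m t)) ->
  (forall t, is_derive m t (ode_field r (m t))) -> isometric_flow (fun t => Phi r (m t)).
Proof.
intros Hr Hm D. exists (metric_r r). intros t. exists (lc_tensor r), (torsion_Phi r (m t)).
split; [now apply torsion_data_Phi|]. intros a b c.
enough (dPhi (m t) (ode_field r (m t)) a b c = Sum n,
  (Sum k, Defs.up (metric_r r) n k * divT (metric_r r) (lc_tensor r) (torsion_Phi r (m t)) k) *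
     star (metric_r r) (Phi r (m t)) n a b c) as <- by now apply is_derive_Phi.
transitivity (Sum n, (div_coef r (m t) n * wt_inv r n) * Psi r (m t) n a b c).
- specialize (Hm t). revert a b c. apply alt3_ext; [apply alt3_dPhi| |].
  { apply alt3_sum. intros n. apply alt4_Psi. }
  assert (Hi : r * / r = 1) by (field; lra).
  intros a b c Hab Hbc. destruct (m t) as [[[h0 h1] h2] h3].
  change (h0 ^ 2 + h1 ^ 2 + h2 ^ 2 + h3 ^ 2 = 1) in Hm.
  assert (Hh' : h0 ^ 2 = 1 - h1 ^ 2 - h2 ^ 2 - h3 ^ 2) by lra.
  (* Writing the inverse of r^2 as (/ r)^2 lets one variable stand for all inverses. *)
  unfold ode_field, Rdiv. rewrite <- pow_inv.
  destruct a, b; try discriminate Hab; destruct c; try discriminate Hbc;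
    cbv -[Rplus Rmult Rminus Ropp Rinv IZR pow];
    set (ri := / r) in *; clearbody ri; ring [Hh' Hi].
- apply sum7_ext; intros n. rewrite star_Phi by easy. f_equal.
  rewrite <- (sum7_up r (div_coef r (m t))). apply sum7_ext; intros k.
  rewrite divT_Phi by easy. rewrite Rmult_comm. f_equal.
  destruct n, k; cbv -[Rplus Rmult Rinv IZR]; ring.
Qed.

(** * The ODE *)

Definition rate (r : R) : R := 2 * (r ^ 3 + 2) * (r ^ 3 - 1) / r ^ 2.

(** By |m| = 1 the j-component - (m_0^2 + m_1^2 + m_3^2) becomes m_2^2 - 1, so the field is c m_2
    (m_2 m - j). *)
Lemma ode_fieldE (r : R) (m : H) : 0 < r -> Sp1 m ->
  ode_field r m =
  (rate r * q2 m * (q2 m * q0 m), rate r * q2 m * (q2 m * q1 m),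
   rate r * q2 m * (q2 m * q2 m - 1), rate r * q2 m * (q2 m * q3 m)).
Proof.
intros Hr Hm. unfold Sp1 in Hm. unfold ode_field, rate, qscal, dot.
destruct m as [[[a0 a1] a2] a3]; cbn in *.
repeat apply (f_equal2 pair); try (field; lra).
replace (a2 * a2 - 1) with (- (a0 * a0 + a1 * a1 + a3 * a3)) by nra. field; lra.
Qed.

(* The radicand is the squared norm of the quaternion when [Sp1 a], so this is its
   normalisation, which depends on [x : y] only. *)
Definition flow_pt (a : H) (x y : R) : H :=
  qscal (/ sqrt ((1 - q2 a ^ 2) * x ^ 2 + q2 a ^ 2 * y ^ 2))
    (x * q0 a, x * q1 a, y * q2 a, x * q3 a).

Lemma Sp1_bound (a : H) : Sp1 a -> 0 <= q2 a ^ 2 <= 1.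
Proof. unfold Sp1; intros; nra. Qed.

Lemma flow_pt_pos (a : H) (x y : R) : Sp1 a ->
  (x <> 0 /\ q2 a ^ 2 <> 1) \/ (y <> 0 /\ q2 a <> 0) ->
  0 < (1 - q2 a ^ 2) * x ^ 2 + q2 a ^ 2 * y ^ 2.
Proof.
intros Ha%Sp1_bound Hxy.
pose proof (pow2_ge_0 x) as X. pose proof (pow2_ge_0 y) as Y.
assert (0 <= (1 - q2 a ^ 2) * x ^ 2) by (apply Rmult_le_pos; lra).
assert (0 <= q2 a ^ 2 * y ^ 2) by (apply Rmult_le_pos; lra).
destruct Hxy as [[Hx Hq]|[Hy Hq]].
- apply pow2_gt_0 in Hx.
  assert (0 < (1 - q2 a ^ 2) * x ^ 2) by (apply Rmult_lt_0_compat; lra). lra.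
- apply pow2_gt_0 in Hy. apply pow2_gt_0 in Hq.
  assert (0 < q2 a ^ 2 * y ^ 2) by (apply Rmult_lt_0_compat; lra). lra.
Qed.

Lemma Sp1_flow_pt (a : H) (x y : R) : Sp1 a ->
  0 < (1 - q2 a ^ 2) * x ^ 2 + q2 a ^ 2 * y ^ 2 -> Sp1 (flow_pt a x y).
Proof.
intros Ha Hp. unfold Sp1, flow_pt in *.
pose proof (sqrt_lt_R0 _ Hp) as Hs. pose proof (sqrt_sqrt _ (Rlt_le _ _ Hp)) as Hss.
set (s := sqrt _) in *. clearbody s.
destruct a as [[[a0 a1] a2] a3]; cbn in *.
apply (Rmult_eq_reg_l (s * s)); [|nra].
transitivity ((x * a0) ^ 2 + (x * a1) ^ 2 + (y * a2) ^ 2 + (x * a3) ^ 2); [field; lra|].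
rewrite Hss.
replace 1 with (a0 * (a0 * 1) + a1 * (a1 * 1) + a2 * (a2 * 1) + a3 * (a3 * 1)) at 1. ring.
Qed.

Definition flow (r : R) (a : H) (t : R) : H := flow_pt a 1 (exp (- rate r * t)).

Lemma Sp1_flow (r : R) (a : H) (t : R) : Sp1 a -> Sp1 (flow r a t).
Proof.
intros Ha. apply Sp1_flow_pt, flow_pt_pos; [easy..|].
pose proof (exp_pos (- rate r * t)).
destruct (Req_dec (q2 a) 0) as [E|E]; [left; rewrite E|right]; split; lra.
Qed.

Lemma is_derive_flow (r : R) (a : H) (t : R) : 0 < r -> Sp1 a ->
  is_derive (flow r a) t (ode_field r (flow r a t)).
Proof.
intros Hr Ha. rewrite ode_fieldE by (easy || now apply Sp1_flow).
assert (Hp : 0 < (1 - q2 a ^ 2) * 1 ^ 2 + q2 a ^ 2 * exp (- rate r * t) ^ 2).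
{ apply flow_pt_pos; [easy|]. pose proof (exp_pos (- rate r * t)).
  destruct (Req_dec (q2 a) 0) as [E|E]; [left; rewrite E|right]; split; lra. }
pose proof (sqrt_lt_R0 _ Hp) as Hs. pose proof (sqrt_sqrt _ (Rlt_le _ _ Hp)) as Hss.
apply is_derive_H. unfold flow, flow_pt. destruct a as [[[a0 a1] a2] a3]; cbn in *.
set (c := rate r) in *; clearbody c.
split; [|split; [|split]]; auto_derive; try (cbn; repeat split; try easy; lra);
  match goal with |- context [sqrt ?u] => set (s := sqrt u) in * end;
  cbn in *; set (E := exp (- c * t)) in *; clearbody E s; field; lra.
Qed.

(** At the end where exp(- c t) blows up, this trades the ratio [1 : exp(- c t)] for [exp(c t) : 1],
    which converges. *)
Lemma flow_pt_homogeneous (a : H) (k x y : R) : Sp1 a -> 0 < k ->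
  0 < (1 - q2 a ^ 2) * x ^ 2 + q2 a ^ 2 * y ^ 2 ->
  flow_pt a (k * x) (k * y) = flow_pt a x y.
Proof.
intros Ha Hk Hp. unfold flow_pt.
replace ((1 - q2 a ^ 2) * (k * x) ^ 2 + q2 a ^ 2 * (k * y) ^ 2)
  with (k * k * ((1 - q2 a ^ 2) * x ^ 2 + q2 a ^ 2 * y ^ 2)) by ring.
rewrite sqrt_mult_alt, sqrt_square by nra.
pose proof (sqrt_lt_R0 _ Hp) as Hs. set (s := sqrt _) in *. clearbody s.
unfold qscal; cbn. repeat apply (f_equal2 pair); field; lra.
Qed.

(** At [0 : 1] the radicand is q2 a ^ 2, so the square root stays differentiable exactly off the
    equator; in the next lemma it is 1 - q2 a ^ 2, and the poles are excluded instead. *)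
Lemma continuous_flow_pt_l (a : H) : Sp1 a -> q2 a <> 0 ->
  filterlim (fun x => flow_pt a x 1) (locally 0) (locally (flow_pt a 0 1)).
Proof.
intros Ha Hq.
assert (Hp : 0 < (1 - q2 a ^ 2) * 0 ^ 2 + q2 a ^ 2 * 1 ^ 2)
  by (apply flow_pt_pos; [easy|right; split; lra]).
pose proof (sqrt_lt_R0 _ Hp) as Hs.
apply filterlim_H; [exact _|..];
  match goal with |- filterlim ?f (locally ?x) _ => apply (ex_derive_continuous f x) end;
  unfold flow_pt, qscal; cbn; cbn in Hp, Hs; auto_derive;
  repeat split; try easy; lra.
Qed.

Lemma continuous_flow_pt_r (a : H) : Sp1 a -> q2 a ^ 2 <> 1 ->
  filterlim (flow_pt a 1) (locally 0) (locally (flow_pt a 1 0)).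
Proof.
intros Ha Hq.
assert (Hp : 0 < (1 - q2 a ^ 2) * 1 ^ 2 + q2 a ^ 2 * 0 ^ 2)
  by (apply flow_pt_pos; [easy|left; split; lra]).
pose proof (sqrt_lt_R0 _ Hp) as Hs.
apply filterlim_H; [exact _|..];
  match goal with |- filterlim ?f (locally ?x) _ => apply (ex_derive_continuous f x) end;
  unfold flow_pt, qscal; cbn; cbn in Hp, Hs; auto_derive;
  repeat split; try easy; lra.
Qed.

Lemma in_RP2_iff (h : H) : Sp1 h -> in_RP2 h <-> q2 h = 0.
Proof.
intros Hh. split.
- intros (h0 & h1 & h3 & _ & [->| ->]); cbn; ring.
- destruct h as [[[h0 h1] h2] h3]. intros E. change (h2 = 0) in E. subst h2.
  exists h0, h1, h3. now split; [|left].
Qed.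

Lemma in_NS_iff (h : H) : Sp1 h -> in_NS h <-> q2 h ^ 2 = 1.
Proof.
intros Hh. split.
- intros [->| ->]; cbn; ring.
- unfold Sp1 in Hh. destruct h as [[[h0 h1] h2] h3]. cbn in *. intros E.
  assert (h0 = 0) by nra. assert (h1 = 0) by nra. assert (h3 = 0) by nra. subst.
  unfold in_NS, same_class, qscal; cbn.
  assert (h2 = 1 \/ h2 = -1) as [->| ->].
  { assert ((h2 - 1) * (h2 + 1) = 0) as [|]%Rmult_integral by lra; [left|right]; lra. }
  + now left.
  + right. repeat apply (f_equal2 pair); ring.
Qed.

Lemma flow_fixed (r : R) (a : H) (t : R) : Sp1 a ->
  r = 1 \/ q2 a = 0 \/ q2 a ^ 2 = 1 -> flow r a t = a.
Proof.
intros Ha Hc. unfold flow, flow_pt.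
set (y := exp _). assert (Hy : 0 < y) by apply exp_pos.
assert (Hy1 : r = 1 -> y = 1).
{ intros ->. unfold y, rate. transitivity (exp 0); [f_equal; field|apply exp_0]. }
clearbody y.
(* At a pole the norm is y and cancels the factor y of the only nonzero component; in the other
   stationary cases it is 1. *)
assert (E : sqrt ((1 - q2 a ^ 2) * 1 ^ 2 + q2 a ^ 2 * y ^ 2) =
            if Req_dec_T (q2 a ^ 2) 1 then y else 1).
{ destruct (Req_dec_T (q2 a ^ 2) 1) as [D|D].
  - rewrite D. replace (_ + _) with (y * y) by ring. apply sqrt_square; lra.
  - transitivity (sqrt 1); [f_equal|apply sqrt_1].
    destruct Hc as [H1|[->|H1]]; [rewrite (Hy1 H1)| |easy]; ring. }
rewrite E; clear E. destruct (Req_dec_T (q2 a ^ 2) 1) as [D|D].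
- unfold Sp1 in Ha. destruct a as [[[a0 a1] a2] a3]; unfold qscal; cbn in *.
  assert (a0 = 0) by nra. assert (a1 = 0) by nra. assert (a3 = 0) by nra. subst.
  repeat apply (f_equal2 pair); field; lra.
- assert (E : y * q2 a = q2 a) by (destruct Hc as [H1|[->|H1]]; [rewrite (Hy1 H1)| |easy]; ring).
  rewrite E. destruct a as [[[a0 a1] a2] a3]; unfold qscal; cbn.
  repeat apply (f_equal2 pair); field.
Qed.

(** The matrix of the ODE is skew, so |m|^2 is constant. This is proved for an arbitrary solution,
    so that [ode_fieldE] applies in the uniqueness proof. *)
Lemma Sp1_solution (r : R) (m : R -> H) (a : H) : 0 < r -> Sp1 a ->
  all_time_solution r a m -> forall t, Sp1 (m t).
Proof.
intros Hr Ha [H0 D].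
set (N := fun t => q0 (m t) ^ 2 + q1 (m t) ^ 2 + q2 (m t) ^ 2 + q3 (m t) ^ 2).
assert (DN : forall t, is_derive N t 0).
{ intros t. pose proof (proj1 (is_derive_H _ _ _) (D t)) as (D0 & D1 & D2 & D3).
  unfold N.
  set (f0 := fun s => q0 (m s)). set (f1 := fun s => q1 (m s)).
  set (f2 := fun s => q2 (m s)). set (f3 := fun s => q3 (m s)).
  change (is_derive f0 t (q0 (ode_field r (m t)))) in D0.
  change (is_derive f1 t (q1 (ode_field r (m t)))) in D1.
  change (is_derive f2 t (q2 (ode_field r (m t)))) in D2.
  change (is_derive f3 t (q3 (ode_field r (m t)))) in D3.
  apply (is_derive_ext (fun s => f0 s ^ 2 + f1 s ^ 2 + f2 s ^ 2 + f3 s ^ 2)); [reflexivity|].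
  auto_derive.
  { repeat split; eexists; eassumption. }
  replace (Derive (fun x => f0 x) t) with (q0 (ode_field r (m t)))
    by (symmetry; now apply is_derive_unique).
  replace (Derive (fun x => f1 x) t) with (q1 (ode_field r (m t)))
    by (symmetry; now apply is_derive_unique).
  replace (Derive (fun x => f2 x) t) with (q2 (ode_field r (m t)))
    by (symmetry; now apply is_derive_unique).
  replace (Derive (fun x => f3 x) t) with (q3 (ode_field r (m t)))
    by (symmetry; now apply is_derive_unique).
  unfold f0, f1, f2, f3. destruct (m t) as [[[x0 x1] x2] x3].
  cbv [ode_field dot qscal q0 q1 q2 q3 fst snd]. field. lra. }
assert (HN : N 0 = 1) by (unfold N; now rewrite H0).
intros t. change (N t = 1).
destruct (Rtotal_order t 0) as [Ht|[->|Ht]]; [|easy|].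
- rewrite <- HN. apply (eq_is_derive N); [intros; apply DN|easy].
- rewrite <- HN. symmetry. apply (eq_is_derive N); [intros; apply DN|easy].
Qed.

(** The field is cubic, hence not globally Lipschitz, but both solutions stay on the sphere. There 1
    - <m, n> is half the squared distance, and it satisfies a linear differential inequality. *)
Lemma solution_unique (r : R) (m n : R -> H) (a : H) : 0 < r -> Sp1 a ->
  all_time_solution r a m -> all_time_solution r a n -> forall t, n t = m t.
Proof.
intros Hr Ha Hm Hn.
pose proof (Sp1_solution r m a Hr Ha Hm) as Sm.
pose proof (Sp1_solution r n a Hr Ha Hn) as Sn.
destruct Hm as [Hm0 Dm], Hn as [Hn0 Dn].
set (c := rate r).
set (f := fun t => 1 - dot (m t) (n t)).
assert (Df : forall t, is_derive f t
   (c * ((q2 (m t) ^ 2 + q2 (n t) ^ 2) * f t - (q2 (m t) - q2 (n t)) ^ 2))).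
{ intros t.
  pose proof (proj1 (is_derive_H _ _ _) (Dm t)) as (D0 & D1 & D2 & D3).
  pose proof (proj1 (is_derive_H _ _ _) (Dn t)) as (E0 & E1 & E2 & E3).
  rewrite ode_fieldE in D0, D1, D2, D3, E0, E1, E2, E3 by easy.
  unfold f, dot. fold c in D0, D1, D2, D3, E0, E1, E2, E3.
  set (f0 := fun s => q0 (m s)). set (f1 := fun s => q1 (m s)).
  set (f2 := fun s => q2 (m s)). set (f3 := fun s => q3 (m s)).
  set (g0 := fun s => q0 (n s)). set (g1 := fun s => q1 (n s)).
  set (g2 := fun s => q2 (n s)). set (g3 := fun s => q3 (n s)).
  change (is_derive f0 t (c * f2 t * (f2 t * f0 t))) in D0.
  change (is_derive f1 t (c * f2 t * (f2 t * f1 t))) in D1.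
  change (is_derive f2 t (c * f2 t * (f2 t * f2 t - 1))) in D2.
  change (is_derive f3 t (c * f2 t * (f2 t * f3 t))) in D3.
  change (is_derive g0 t (c * g2 t * (g2 t * g0 t))) in E0.
  change (is_derive g1 t (c * g2 t * (g2 t * g1 t))) in E1.
  change (is_derive g2 t (c * g2 t * (g2 t * g2 t - 1))) in E2.
  change (is_derive g3 t (c * g2 t * (g2 t * g3 t))) in E3.
  apply (is_derive_ext (fun s =>
    1 - (f0 s * g0 s + f1 s * g1 s + f2 s * g2 s + f3 s * g3 s))); [reflexivity|].
  change (q0 (m t)) with (f0 t). change (q1 (m t)) with (f1 t).
  change (q2 (m t)) with (f2 t). change (q3 (m t)) with (f3 t).
  change (q0 (n t)) with (g0 t). change (q1 (n t)) with (g1 t).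
  change (q2 (n t)) with (g2 t). change (q3 (n t)) with (g3 t).
  clearbody f0 f1 f2 f3 g0 g1 g2 g3.
  auto_derive.
  { repeat split; eexists; eassumption. }
  repeat match goal with
  | E : is_derive ?f t ?d |- context [Derive ?g t] => rewrite (is_derive_unique g t d E)
  end.
  ring. }
assert (N : forall t, 2 * f t =
  (q0 (m t) - q0 (n t)) ^ 2 + (q1 (m t) - q1 (n t)) ^ 2 +
  (q2 (m t) - q2 (n t)) ^ 2 + (q3 (m t) - q3 (n t)) ^ 2).
{ intros t. pose proof (Sm t) as S1. pose proof (Sn t) as S2.
  unfold Sp1 in S1, S2. unfold f, dot.
  match type of S1 with ?u = 1 => match type of S2 with ?v = 1 =>
    transitivity (u + v - 2 * dot (m t) (n t)) end end; unfold dot.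
  - rewrite S1, S2. ring.
  - ring. }
assert (P : forall t, 0 <= f t /\ (q2 (m t) - q2 (n t)) ^ 2 <= 2 * f t).
{ intros t. rewrite (N t). specialize (N t).
  pose proof (pow2_ge_0 (q0 (m t) - q0 (n t))). pose proof (pow2_ge_0 (q1 (m t) - q1 (n t))).
  pose proof (pow2_ge_0 (q2 (m t) - q2 (n t))). pose proof (pow2_ge_0 (q3 (m t) - q3 (n t))).
  lra. }
assert (Z : forall t, f t = 0).
(* The two terms in the derivative both lie between 0 and 2 f, up to the factor c, so 4 |c| is a
   sufficient constant. *)
{ apply (gronwall_zero f _ (4 * Rabs c)) with (3 := Df).
  - intros t. apply P.
  - unfold f. rewrite Hm0, Hn0. unfold Sp1 in Ha. unfold dot. lra.
  - intros t. rewrite Rabs_mult.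
    rewrite (Rmult_comm 4), Rmult_assoc. apply Rmult_le_compat_l; [apply Rabs_pos|].
    pose proof (Sp1_bound _ (Sm t)). pose proof (Sp1_bound _ (Sn t)).
    pose proof (P t). pose proof (pow2_ge_0 (q2 (m t) - q2 (n t))).
    apply Rabs_le. nra. }
intros t. specialize (N t). rewrite Z in N.
pose proof (pow2_ge_0 (q0 (m t) - q0 (n t))). pose proof (pow2_ge_0 (q1 (m t) - q1 (n t))).
pose proof (pow2_ge_0 (q2 (m t) - q2 (n t))). pose proof (pow2_ge_0 (q3 (m t) - q3 (n t))).
assert (S : forall x y, (x - y) ^ 2 = 0 -> y = x).
{ intros x y E. assert (x - y = 0) by nra. lra. }
assert (E0 : q0 (n t) = q0 (m t)) by (apply S; lra).
assert (E1 : q1 (n t) = q1 (m t)) by (apply S; lra).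
assert (E2 : q2 (n t) = q2 (m t)) by (apply S; lra).
assert (E3 : q3 (n t) = q3 (m t)) by (apply S; lra).
destruct (m t) as [[[x0 x1] x2] x3], (n t) as [[[y0 y1] y2] y3].
cbn in E0, E1, E2, E3. now subst.
Qed.

Lemma lim_RP3_of_lim (F : (R -> Prop) -> Prop) {FF : Filter F} (m : R -> H) (h : H) :
  filterlim m F (locally h) -> lim_RP3 F m h.
Proof.
intros Hm U HU. apply (filter_imp (fun t => U (m t))); [|now apply Hm].
intros t Ut. exists (m t). split; [now left|easy].
Qed.

(** Stated for any filter along which exp(- c t) vanishes, so that it covers t -> +oo when c > 0 and
    t -> -oo when c < 0. A pole is stationary and is its own limit. *)
Lemma flow_lim_RP2 (r : R) (a : H) (F : (R -> Prop) -> Prop) {FF : Filter F} : Sp1 a ->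
  filterlim (fun t => exp (- rate r * t)) F (locally 0) ->
  exists h, Sp1 h /\ filterlim (flow r a) F (locally h) /\
    (in_RP2 h \/ in_NS h) /\ (~ in_NS a -> in_RP2 h).
Proof.
intros Ha HF. destruct (Req_dec (q2 a ^ 2) 1) as [E|E].
- exists a. assert (in_NS a) by now apply in_NS_iff.
  split; [easy|]. split; [|tauto].
  apply (filterlim_ext (fun _ => a)); [|apply filterlim_const].
  intros t. symmetry. apply flow_fixed; tauto.
- exists (flow_pt a 1 0).
  assert (S : Sp1 (flow_pt a 1 0)).
  { apply Sp1_flow_pt, flow_pt_pos; [easy..|]. left; split; lra. }
  assert (in_RP2 (flow_pt a 1 0)).
  { apply in_RP2_iff; [easy|]. unfold flow_pt, qscal. cbn. ring. }
  split; [easy|]. split; [|tauto].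
  apply (filterlim_comp _ _ _ _ (flow_pt a 1) _ _ _ HF).
  now apply continuous_flow_pt_r.
Qed.

(** The opposite end: exp(c t) vanishes and the j-component dominates, unless it is zero from the
    start and the point is stationary. *)
Lemma flow_lim_NS (r : R) (a : H) (F : (R -> Prop) -> Prop) {FF : Filter F} : Sp1 a ->
  filterlim (fun t => exp (rate r * t)) F (locally 0) ->
  exists h, Sp1 h /\ filterlim (flow r a) F (locally h) /\
    (in_RP2 h \/ in_NS h) /\ (~ in_RP2 a -> in_NS h).
Proof.
intros Ha HF. destruct (Req_dec (q2 a) 0) as [E|E].
- exists a. assert (in_RP2 a) by now apply in_RP2_iff.
  split; [easy|]. split; [|tauto].
  apply (filterlim_ext (fun _ => a)); [|apply filterlim_const].
  intros t. symmetry. apply flow_fixed; tauto.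
- exists (flow_pt a 0 1).
  assert (Hp : 0 < (1 - q2 a ^ 2) * 0 ^ 2 + q2 a ^ 2 * 1 ^ 2).
  { apply flow_pt_pos; [easy|]. right; split; lra. }
  pose proof (Sp1_flow_pt a 0 1 Ha Hp) as S.
  assert (in_NS (flow_pt a 0 1)).
  { apply in_NS_iff; [easy|]. revert S. unfold Sp1, flow_pt, qscal. cbn. lra. }
  split; [easy|]. split; [|tauto].
  (* Both homogeneous coordinates are multiplied by exp(c t). *)
  apply (filterlim_ext (fun t => flow_pt a (exp (rate r * t)) 1)).
  { intros t. unfold flow. pose proof (exp_pos (rate r * t)).
    rewrite <- (flow_pt_homogeneous a (exp (rate r * t)) 1); [|easy..|].
    - rewrite Rmult_1_r, <- exp_plus. f_equal. rewrite <- exp_0. f_equal. ring.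
    - apply flow_pt_pos; [easy|]. right. split; [|easy].
      apply Rgt_not_eq, exp_pos. }
  apply (filterlim_comp _ _ _ _ (fun x => flow_pt a x 1) _ _ _ HF).
  now apply continuous_flow_pt_l.
Qed.

Lemma rate_sign (r : R) : 0 < r -> (r < 1 -> rate r < 0) /\ (1 < r -> 0 < rate r).
Proof.
intros Hr. unfold rate.
assert (0 < 2 * (r ^ 3 + 2) / r ^ 2).
{ apply Rdiv_lt_0_compat; [|now apply pow_lt]. pose proof (pow_lt r 3 Hr). lra. }
replace (2 * (r ^ 3 + 2) * (r ^ 3 - 1) / r ^ 2) with (2 * (r ^ 3 + 2) / r ^ 2 * (r ^ 3 - 1))
  by (field; lra).
split; intros H1.
- assert (r ^ 3 < 1) by nra. nra.
- assert (1 < r ^ 3) by nra. nra.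
Qed.

(** The case r = 1 is kept apart: nothing moves, so the limits may lie outside both RP^2 and NS, and
    harmonicity comes from the factor r^3 - 1 instead. *)
Lemma flow_limits (r : R) (a : H) : 0 < r -> Sp1 a ->
  exists m_minus m_plus, Sp1 m_minus /\ Sp1 m_plus /\
    filterlim (flow r a) (Rbar_locally m_infty) (locally m_minus) /\
    filterlim (flow r a) (Rbar_locally p_infty) (locally m_plus) /\
    (r = 1 /\ m_minus = a /\ m_plus = a \/
     (in_RP2 m_minus \/ in_NS m_minus) /\ (in_RP2 m_plus \/ in_NS m_plus)) /\
    (r < 1 -> (~ in_NS a -> in_RP2 m_minus) /\ (~ in_RP2 a -> in_NS m_plus)) /\
    (1 < r -> (~ in_NS a -> in_RP2 m_plus) /\ (~ in_RP2 a -> in_NS m_minus)).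
Proof.
intros Hr Ha. destruct (rate_sign r Hr) as [R1 R2].
destruct (Rtotal_order r 1) as [H1|[H1|H1]].
- specialize (R1 H1).
  destruct (flow_lim_RP2 r a (Rbar_locally m_infty)) as (h & ? & ? & ? & ?);
    [easy|apply filterlim_exp_zero; left; split; [lra|easy]|].
  destruct (flow_lim_NS r a (Rbar_locally p_infty)) as (k & ? & ? & ? & ?);
    [easy|apply filterlim_exp_zero; right; split; [lra|easy]|].
  exists h, k. repeat (split; [easy|]). split; [now right|].
  split; [easy|lra].
- exists a, a.
  assert (L : forall F, Filter F -> filterlim (flow r a) F (locally a)).
  { intros F HF. apply (filterlim_ext (fun _ => a)); [|apply filterlim_const].
    intros t. symmetry. apply flow_fixed; tauto. }
  do 2 (split; [easy|]). do 2 (split; [apply L, Rbar_locally_filter|]).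
  split; [now left|]. split; lra.
- specialize (R2 H1).
  destruct (flow_lim_RP2 r a (Rbar_locally p_infty)) as (h & ? & ? & ? & ?);
    [easy|apply filterlim_exp_zero; right; split; [lra|easy]|].
  destruct (flow_lim_NS r a (Rbar_locally m_infty)) as (k & ? & ? & ? & ?);
    [easy|apply filterlim_exp_zero; left; split; [lra|easy]|].
  exists k, h. repeat (split; [easy|]). split; [now right|].
  split; [lra|easy].
Qed.

(** The exclusions of NS and RP^2 concern stationary initial points. Coclosedness is conditional at
    r = 1 because there every point is its own limit, and off RP^2 and NS the torsion is not
    symmetric. *)
Theorem theorem6 : forall (r : R) (m_init : H), 0 < r -> Sp1 m_init ->
  exists m : R -> H,
    all_time_solution r m_init m /\
    (forall m', all_time_solution r m_init m' -> forall t, m' t = m t) /\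
    (forall t, Sp1 (m t)) /\
    isometric_flow (fun t => Phi r (m t)) /\
    exists m_minus m_plus : H,
      Sp1 m_minus /\ Sp1 m_plus /\
      (exists t_ : nat -> R, is_lim_seq t_ m_infty /\
         filterlim (fun n => m (t_ n)) eventually (locally m_minus)) /\
      (exists t_ : nat -> R, is_lim_seq t_ p_infty /\
         filterlim (fun n => m (t_ n)) eventually (locally m_plus)) /\
      Ad_invariant (Phi r m_minus) /\ harmonic (Phi r m_minus) /\
      Ad_invariant (Phi r m_plus) /\ harmonic (Phi r m_plus) /\
      (r <> 1 \/ in_RP2 m_init \/ in_NS m_init ->
         coclosed (Phi r m_minus) /\ coclosed (Phi r m_plus)) /\
      lim_RP3 (Rbar_locally m_infty) m m_minus /\
      lim_RP3 (Rbar_locally p_infty) m m_plus /\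
      (r < 1 ->
         (~ in_NS m_init -> in_RP2 m_minus) /\
         (~ in_RP2 m_init -> in_NS m_plus)) /\
      (1 < r ->
         (~ in_NS m_init -> in_RP2 m_plus) /\
         (~ in_RP2 m_init -> in_NS m_minus)).
Proof.
intros r a Hr Ha.
assert (Hsol : all_time_solution r a (flow r a)).
{ split; [|intros t; now apply is_derive_flow].
  unfold flow. rewrite Rmult_0_r, exp_0. unfold flow_pt.
  replace (_ + _) with 1 by ring. rewrite sqrt_1.
  destruct a as [[[a0 a1] a2] a3]; unfold qscal; cbn.
  repeat apply (f_equal2 pair); field. }
exists (flow r a).
split; [easy|].
split; [intros m' Hm'; now apply (solution_unique r _ _ a)|].
split; [intros t; now apply Sp1_flow|].
split; [apply isometric_flow_Phi; [easy|intros t; now apply Sp1_flow|apply Hsol]|].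
destruct (flow_limits r a Hr Ha) as (h & k & Sh & Sk & Lh & Lk & Hc & L1 & L2).
assert (Hx : forall x, Sp1 x -> in_RP2 x \/ in_NS x ->
           q2 x = 0 \/ q0 x = 0 /\ q1 x = 0 /\ q3 x = 0).
{ intros x Sx [Hx|Hx]; [left; now apply in_RP2_iff|right].
  apply in_NS_iff in Hx; [|easy]. unfold Sp1 in Sx.
  split; [|split]; nra. }
exists h, k. do 2 (split; [easy|]).
(* The whole flow line converges at both ends, so the integers serve as times. *)
split; [exists (fun n => - INR n)|split; [exists INR|]].
1, 2: split; [|eapply filterlim_comp; [|eassumption]].
1, 2: apply (is_lim_seq_opp INR p_infty), is_lim_seq_INR.
1, 2: apply is_lim_seq_INR.
split; [apply Ad_invariant_Phi|].
split; [apply harmonic_Phi; [easy..|]|].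
{ destruct Hc as [Hc|[Hc _]]; [tauto|right; now apply Hx]. }
split; [apply Ad_invariant_Phi|].
split; [apply harmonic_Phi; [easy..|]|].
{ destruct Hc as [Hc|[_ Hc]]; [tauto|right; now apply Hx]. }
split; [intros H1; split; apply coclosed_Phi; [easy..| |easy|easy|]|].
(* If r = 1 both limits are the initial point, which the hypothesis then places in RP^2 or NS. *)
1, 2: apply Hx; [easy|]; destruct Hc as [(E & -> & ->)|Hc]; tauto.
split; [apply lim_RP3_of_lim; [apply Rbar_locally_filter|easy]|].
split; [apply lim_RP3_of_lim; [apply Rbar_locally_filter|easy]|].
easy.
Qed.
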